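(* Let $(\mathcal{A},\gamma,\mathbb{T})$ be a full $C^*$-dynamical system with $\mathcal{A}$ unital, and let $\beta\in\mathbb{R}$. The maps $\omega\mapsto\omega|_{\mathcal{A}^0}$ and $\tau\mapsto\tau\circ F_0$ set up a bijective correspondence between the set of KMS states $\omega$ of $(\mathcal{A},\gamma)$ at inverse temperature $\beta$ and the set $\mathcal{TS}_{e^\beta}$ of tracial states $\tau$ on $\mathcal{A}^0$ such that $e^{\beta}\tau(xy^* )=\tau(y^*x)$ for all $x,y\in\mathcal{A}^1$.
   Context: $\gamma$ is a (strongly continuous) action of $\mathbb{T}$ on $\mathcal{A}$ by $*$-automorphisms, and $\mathcal{A}^k=\{a\in\mathcal{A}:\gamma_z(a)=z^ka\ \forall z\in\mathbb{T}\}$ for $k\in\mathbb{Z}$. The system is full if for every $k\in\mathbb{Z}$ the closed linear span of $\{xy:x\in\mathcal{A}^k,y\in\mathcal{A}^{-k}\}$ equals $\mathcal{A}^0$. $F_0:\mathcal{A}\to\mathcal{A}^0$ is the conditional expectation obtained by averaging over the $\mathbb{T}$-action. Put $\alpha_t=\gamma_{e^{it}}$, $t\in\mathbb{R}$. A state $\omega$ of $\mathcal{A}$ is a KMS state of $(\mathcal{A},\gamma)$ at inverse temperature $\beta$ if $\omega(a\alpha_{i\beta}(b))=\omega(ba)$ for all $a,b$ in a dense $*$-subalgebra of entire elements for $\alpha$ (equivalently, for all $a,b$ in the linear span of the spaces $\mathcal{A}^k$, $k\in\mathbb{Z}$).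
   Formalization: At inverse temperature β = 0, KMS states are additionally required to be invariant under the action γ, since otherwise the claim fails (for rotation on C(𝕋) every state is a trace, but TS_1 is a single point); for β ≠ 0 nothing is changed. *)

(* Defs.v *)
From HB Require Import structures.
From mathcomp Require Import all_boot all_order all_algebra.
From mathcomp Require Import complex.
From mathcomp Require Import all_classical all_reals all_analysis.

Set Implicit Arguments.
Unset Strict Implicit.
Unset Printing Implicit Defensive.

Import Order.TTheory GRing.Theory Num.Theory numFieldNormedType.Exports.

Local Open Scope classical_set_scope.
Local Open Scope complex_scope.
Local Open Scope ring_scope.

HB.mixin Record Algebra_isStarAlgebra (K : numClosedFieldType) A
    & GRing.Algebra K A := {
  star : A -> A;
  starK : involutive star;
  starD : {morph star : a b / a + b};
  starZ : forall (z : K) (a : A), star (z *: a) = Num.conj z *: star a;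
  starM : forall a b : A, star (a * b) = star b * star a
}.

#[short(type="starAlgType")]
HB.structure Definition StarAlgebra (K : numClosedFieldType) :=
  {A of GRing.Algebra K A & Algebra_isStarAlgebra K A}.

(* Unital (nonzero) C*-algebras. No HB structure can inherit both from rings
   and from normed modules (their join would have to sit below numDomainType),
   so the multiplication is a field of the mixin, and the ring, algebra and
   *-algebra structures are then declared on the sort of the structure. *)
HB.mixin Record CompleteNormedModule_isCStarAlgebra
    (K : numClosedFieldType) A & CompleteNormedModule K A := {
  cstar_mul : A -> A -> A;
  cstar_one : A;
  cstar_star : A -> A;
  cstar_mulA : associative cstar_mul;
  cstar_mul1l : left_id cstar_one cstar_mul;
  cstar_mul1r : right_id cstar_one cstar_mul;
  cstar_mulDl : left_distributive cstar_mul +%R;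
  cstar_mulDr : right_distributive cstar_mul +%R;
  cstar_one_neq0 : cstar_one != 0;
  cstar_scalerAl : forall (z : K) (a b : A),
    z *: cstar_mul a b = cstar_mul (z *: a) b;
  cstar_scalerAr : forall (z : K) (a b : A),
    z *: cstar_mul a b = cstar_mul a (z *: b);
  cstar_starK : involutive cstar_star;
  cstar_starD : {morph cstar_star : a b / a + b};
  cstar_starZ : forall (z : K) (a : A),
    cstar_star (z *: a) = Num.conj z *: cstar_star a;
  cstar_starM : forall a b : A,
    cstar_star (cstar_mul a b) = cstar_mul (cstar_star b) (cstar_star a);
  cstar_norm_mul_le : forall a b : A, `|cstar_mul a b| <= `|a| * `|b|;
  cstar_norm_star_mul : forall a : A,
    `|cstar_mul (cstar_star a) a| = `|a| ^+ 2
}.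

#[short(type="cstarAlgType")]
HB.structure Definition CStarAlgebra (K : numClosedFieldType) :=
  {A of CompleteNormedModule K A & CompleteNormedModule_isCStarAlgebra K A}.

Section CStarAlgebraTheory.
Variables (K : numClosedFieldType) (A : cstarAlgType K).

HB.instance Definition _ := GRing.Zmodule_isNzRing.Build A
  (@cstar_mulA K A) (@cstar_mul1l K A) (@cstar_mul1r K A)
  (@cstar_mulDl K A) (@cstar_mulDr K A) (@cstar_one_neq0 K A).
HB.instance Definition _ :=
  GRing.Lmodule_isLalgebra.Build K A (@cstar_scalerAl K A).
HB.instance Definition _ :=
  GRing.Lalgebra_isAlgebra.Build K A (@cstar_scalerAr K A).
HB.instance Definition _ := Algebra_isStarAlgebra.Build K A
  (@cstar_starK K A) (@cstar_starD K A) (@cstar_starZ K A) (@cstar_starM K A).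

Lemma ler_cstar_normM (a b : A) : `|a * b| <= `|a| * `|b|.
Proof. exact: cstar_norm_mul_le. Qed.

Lemma cstar_norm_starM (a : A) : `|star a * a| = `|a| ^+ 2.
Proof. exact: cstar_norm_star_mul. Qed.

End CStarAlgebraTheory.

Section States.
Variables (K : numClosedFieldType) (B : starAlgType K).

Definition is_state (phi : B -> K) : Prop :=
  [/\ scalar phi, (forall b : B, 0 <= phi (star b * b)) & phi 1 = 1].

Definition is_tracial_state (phi : B -> K) : Prop :=
  is_state phi /\ (forall x y : B, phi (x * y) = phi (y * x)).

End States.

Definition lin_span (K : pzRingType) (V : lmodType K) (S : set V) : set V :=
  [set v | exists (n : nat) (c : 'I_n -> K) (x : 'I_n -> V),
     (forall i, S (x i)) /\ v = \sum_i c i *: x i].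

Section Riemann.
Variables (R : realType) (V : normedModType R[i]).

Definition tagged_partition (a b : R) (n : nat) (x xi : nat -> R) : Prop :=
  [/\ x 0%N = a, x n = b & forall i, (i < n)%N -> x i <= xi i <= x i.+1].

Definition riemann_sum (f : R -> V) (n : nat) (x xi : nat -> R) : V :=
  \sum_(i < n) (x i.+1 - x i)%:C *: f (xi i).

Definition is_riemann_integral (f : R -> V) (a b : R) (v : V) : Prop :=
  forall e : R, 0 < e -> exists2 d : R, 0 < d &
    forall (n : nat) (x xi : nat -> R), tagged_partition a b n x xi ->
      (forall i, (i < n)%N -> x i.+1 - x i < d) ->
      `|riemann_sum f n x xi - v| < e%:C.

Definition riemann_integral (f : R -> V) (a b : R) : V :=
  xget 0 [set v | is_riemann_integral f a b v].

(* Entire V-valued functions, as sums of everywhere convergent power series. *)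
Definition is_entire (f : R[i] -> V) : Prop :=
  exists c : nat -> V, forall z : R[i],
    series (fun n => z ^+ n *: c n) @ \oo --> f z.

(* The value at z of the entire function extending g : R -> V (by the identity
   theorem there is at most one); 0 if g has no entire extension. *)
Definition entire_extension (g : R -> V) (z : R[i]) : V :=
  xget (fun=> 0) [set f | is_entire f /\ forall t : R, f t%:C = g t] z.

End Riemann.

Definition expi (R : realType) (t : R) : R[i] := cos t +i* sin t.

(* Strongly continuous actions of the unit circle by *-automorphisms; the
   values off the unit circle are irrelevant. Bijectivity of each
   automorphism follows from the action laws. *)
Record circle_action (R : realType) (A : cstarAlgType R[i]) := CircleAction {
  circle_act :> R[i] -> A -> A;
  circle_act_linear : forall z, `|z| = 1 -> linear (circle_act z);
  circle_actM : forall z, `|z| = 1 -> {morph circle_act z : a b / a * b};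
  circle_act_star : forall z, `|z| = 1 -> {morph circle_act z : a / star a};
  circle_act1 : forall a, circle_act 1 a = a;
  circle_act_mul : forall z w a, `|z| = 1 -> `|w| = 1 ->
    circle_act (z * w) a = circle_act z (circle_act w a);
  circle_act_continuous : forall a : A,
    {within [set z : R[i]^o | `|z| = 1],
       continuous ((fun z => circle_act z a) : R[i]^o -> A)}
}.

Section CircleAction.
Variables (R : realType) (A : cstarAlgType R[i]) (gamma : circle_action A).

Definition spectral (k : int) : set A :=
  [set a | forall z : R[i], `|z| = 1 -> gamma z a = z ^ k *: a].

Definition full_system : Prop :=
  forall k : int,
    closure (lin_span [set x * y | x in spectral k & y in spectral (- k)])
    = spectral 0.

Lemma circle_actZ (z c : R[i]) (a : A) :
  `|z| = 1 -> gamma z (c *: a) = c *: gamma z a.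
Proof.
move=> z1; have lin := circle_act_linear gamma z1.
have g0 : gamma z 0 = 0.
  by have := lin (-1) 0 0; rewrite scaler0 add0r scaleN1r addNr.
by have := lin c a 0; rewrite !addr0 g0 addr0.
Qed.

Lemma circle_act_one (z : R[i]) : `|z| = 1 -> gamma z 1 = 1.
Proof.
move=> z1; have z0 : z != 0 by rewrite -normr_gt0 z1 ltr01.
have zV1 : `|z^-1| = 1 by rewrite normfV z1 invr1.
have zK a : gamma z (gamma z^-1 a) = a.
  by rewrite -circle_act_mul// divff// circle_act1.
by rewrite -[LHS]mulr1 -{2}[1]zK -circle_actM// mul1r zK.
Qed.

Lemma spectral_mul (j k : int) (a b : A) :
  spectral j a -> spectral k b -> spectral (j + k) (a * b).
Proof.
move=> Sa Sb z z1; have z0 : z != 0 by rewrite -normr_gt0 z1 ltr01.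
by rewrite circle_actM// Sa// Sb// -scalerAl -scalerAr scalerA expfzDr.
Qed.

Lemma spectral_star (k : int) (a : A) :
  spectral k a -> spectral (- k) (star a).
Proof.
move=> Sa z z1; rewrite circle_act_star// Sa// starZ; congr (_ *: _).
have zz : z * Num.conj z = 1 by rewrite -normCK z1 expr1n.
have z0 : z != 0 by rewrite -normr_gt0 z1 ltr01.
have -> : Num.conj (z ^ k) = Num.conj z ^ k by rewrite rmorphXz// unitfE.
have -> : Num.conj z = z^-1 by apply: (mulfI z0); rewrite zz divff.
by rewrite exprz_inv.
Qed.

(* The fixed-point algebra, as a unital *-subalgebra. *)
Definition fixed_pred : {pred A} := fun a => a \in spectral 0.

Lemma fixed_predP (a : A) : reflect (spectral 0 a) (a \in fixed_pred).
Proof. by apply: (iffP idP); rewrite unfold_in inE. Qed.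

Lemma fixed_subalg_closed : GRing.subsemialg_closed fixed_pred.
Proof.
split=> [|||a b /fixed_predP Sa /fixed_predP Sb].
- by apply/fixed_predP => z z1; rewrite circle_act_one// expr0z scale1r.
- split=> [|a b /fixed_predP Sa /fixed_predP Sb]; apply/fixed_predP => z z1.
    by rewrite -[in LHS](scale0r 0) circle_actZ// scale0r scaler0.
  have := circle_act_linear gamma z1 1 a b.
  by rewrite !scale1r => ->; rewrite Sa// Sb// !expr0z !scale1r.
- move=> c a /fixed_predP Sa; apply/fixed_predP => z z1.
  by rewrite circle_actZ// Sa// !expr0z !scale1r.
- by apply/fixed_predP; rewrite -[0]addr0; exact: spectral_mul.
Qed.

Definition fixed_alg : Type := {a : A | a \in fixed_pred}.

HB.instance Definition _ := SubChoice.on fixed_alg.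
HB.instance Definition _ := GRing.SubChoice_isSubAlgebra.Build R[i] A
  fixed_pred fixed_alg fixed_subalg_closed.

Definition to_fixed (a : A) (Sa : spectral 0 a) : fixed_alg :=
  Sub a (introT (fixed_predP a) Sa).

Lemma spectral0_star (a : A) : spectral 0 a -> spectral 0 (star a).
Proof. by move=> /spectral_star; rewrite oppr0. Qed.

Definition fixed_star (u : fixed_alg) : fixed_alg :=
  to_fixed (spectral0_star (elimT (fixed_predP _) (valP u))).

Lemma fixed_starK : involutive fixed_star.
Proof. by move=> u; apply: val_inj; rewrite /= starK. Qed.

Lemma fixed_starD : {morph fixed_star : u v / u + v}.
Proof. by move=> u v; apply: val_inj; rewrite /= starD. Qed.

Lemma fixed_starZ (z : R[i]) (u : fixed_alg) :
  fixed_star (z *: u) = Num.conj z *: fixed_star u.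
Proof. by apply: val_inj; rewrite /= starZ. Qed.

Lemma fixed_starM (u v : fixed_alg) :
  fixed_star (u * v) = fixed_star v * fixed_star u.
Proof. by apply: val_inj; rewrite /= starM. Qed.

HB.instance Definition _ := Algebra_isStarAlgebra.Build R[i] fixed_alg
  fixed_starK fixed_starD fixed_starZ fixed_starM.

Lemma spectral1_mul_star (x y : A) :
  spectral 1 x -> spectral 1 y -> spectral 0 (x * star y).
Proof.
by move=> Sx Sy; rewrite -(subrr 1); apply: spectral_mul => //; exact: spectral_star.
Qed.

Lemma spectral1_star_mul (x y : A) :
  spectral 1 x -> spectral 1 y -> spectral 0 (star y * x).
Proof.
by move=> Sx Sy; rewrite -(addNr 1); apply: spectral_mul => //; exact: spectral_star.
Qed.

Definition circle_average (a : A) : A :=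
  ((2 * pi)^-1)%:C *:
    riemann_integral (fun t : R => gamma (expi t) a) 0 (2 * pi).

(* The conditional expectation onto the fixed-point algebra. The average over
   the circle always lies in the fixed-point algebra, so that the default
   value of insubd is never used. *)
Definition expectation (a : A) : fixed_alg := insubd 0 (circle_average a).

Definition flow (t : R) (a : A) : A := gamma (expi t) a.

Definition complex_flow (z : R[i]) (a : A) : A :=
  entire_extension (fun t => flow t a) z.

(* The linear span of the spectral subspaces is a dense *-subalgebra of entire
   elements. For beta = 0 the KMS condition just says that omega is a trace;
   as usual the invariance of omega, which is automatic for beta <> 0, is then
   part of the definition. (On the algebra of continuous functions on the
   circle with the rotation action, which is full, every state is a trace, but
   only the Haar state is determined by its restriction to the fixed-point
   algebra.) *)
Definition is_kms (beta : R) (omega : A -> R[i]) : Prop :=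
  [/\ is_state omega,
      (forall a b : A, lin_span (\bigcup_(k : int) spectral k) a ->
         lin_span (\bigcup_(k : int) spectral k) b ->
         omega (a * complex_flow ('i%C * beta%:C) b) = omega (b * a))
    & beta = 0 -> forall t a, omega (flow t a) = omega a].

Definition scaled_tracial_state (lambda : R) (tau : fixed_alg -> R[i]) : Prop :=
  is_tracial_state tau /\
  forall (x y : A) (Sx : spectral 1 x) (Sy : spectral 1 y),
    lambda%:C * tau (to_fixed (spectral1_mul_star Sx Sy)) =
    tau (to_fixed (spectral1_star_mul Sx Sy)).

Definition restrict_fixed (omega : A -> R[i]) : fixed_alg -> R[i] :=
  fun u => omega (val u).

Definition extend_fixed (tau : fixed_alg -> R[i]) : A -> R[i] :=
  fun a => tau (expectation a).

End CircleAction.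

Arguments restrict_fixed {R A} gamma omega.

(* Main.v *)
(* On A^k the entire extension of the flow at i beta is multiplication by
   e^(-k beta), so the KMS condition reads omega (a b) = e^(k beta) omega (b a)
   for b in A^k. Taking a = 1 (or invariance, if beta = 0), omega vanishes on A^k
   for k <> 0. Averaging against a positive trigonometric kernel shows that the
   spectral subspaces span a dense subspace, whence omega = omega \o F_0.

   Conversely let phi = tau \o F_0. The hypothesis on A^1 propagates to A^k by
   induction, since 1 is a limit of sums of products from A^1 A^(-1). Positivity
   of phi does not need the theorem that b^*b is positive in a C*-algebra: for b
   in A^k, scaling makes phi (b^*b) a positive multiple of phi (b^*b + bb^* ), and
   b^*b + bb^* is a sum of squares of self-adjoint elements. For such sums,
   positivity is the norm condition |t - h| <= t, which passes from A to A^0 and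
   is stable under addition. Square roots of 1 - h with |h| < 1 come from a
   contraction mapping; they give this norm condition, the boundedness of
   positive functionals and the contractivity of *-homomorphisms. *)

From HB Require Import structures.
From mathcomp Require Import all_boot all_order all_algebra.
From mathcomp Require Import complex.
From mathcomp Require Import all_classical all_reals all_analysis.
From mathcomp Require Import ring lra zify.
Require Import Defs.

Set Implicit Arguments.
Unset Strict Implicit.
Unset Printing Implicit Defensive.

Import Order.TTheory GRing.Theory Num.Theory numFieldNormedType.Exports.

Local Open Scope classical_set_scope.
Local Open Scope complex_scope.
Local Open Scope ring_scope.

(** * Real-valued norms *)

(** Two objects are hard to compute from their definitions: F_0 is a Riemann integral and the flow
    at i beta is a chosen entire extension. In place of the integral, the proof works with limits of
    means over the 2^n-th roots of unity. Such a mean is a finite sum, so it commutes with linear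
    maps and respects norm bounds, and for m <> 0 it annihilates z^m v exactly once n is large. The
    Riemann integral is met only once: primitives compute it on sums of spectral elements, and
    density does the rest.

    The obstacle to positivity is that tau sees only A^0. The self-adjoint elements whose squares
    are summed mix the degrees k and -k, and only the sum of their squares lies in A^0; hence a
    criterion that speaks of norms in place of the summands. A general element is approximated by a
    sum of elements of distinct degrees. Its cross terms have nonzero degree and vanish under phi,
    so that positivity reduces to a single degree. *)

Section RealNorm.
Variables (R : realType) (V : normedModType R[i]).
Implicit Types u v w : V.

(* In a normed module over R[i] the norm `|v| is a complex number; nrm v is the
   same number as an element of R. *)
Definition nrm (v : V) : R := complex.Re `|v|.

Lemma nrmE v : `|v| = (nrm v)%:C.
Proof. by rewrite /nrm RRe_real// normr_real. Qed.

Lemma nrm_ge0 v : 0 <= nrm v.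
Proof. by rewrite -lecR -nrmE normr_ge0. Qed.

Lemma nrm0 : nrm 0 = 0.
Proof. by rewrite /nrm normr0. Qed.

Lemma nrm_eq0 v : nrm v = 0 -> v = 0.
Proof. by move=> v0; apply/normr0_eq0; rewrite nrmE v0. Qed.

Lemma nrmD v w : nrm (v + w) <= nrm v + nrm w.
Proof. by rewrite -lecR rmorphD/= -!nrmE ler_normD. Qed.

Lemma nrmN v : nrm (- v) = nrm v.
Proof. by rewrite /nrm normrN. Qed.

Lemma nrm_distC v w : nrm (v - w) = nrm (w - v).
Proof. by rewrite -nrmN opprB. Qed.

Lemma nrmB v w : nrm (v - w) <= nrm v + nrm w.
Proof. by rewrite -(nrmN w) nrmD. Qed.

Lemma nrm_triangle u v w : nrm (v - w) <= nrm (v - u) + nrm (u - w).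
Proof. by rewrite -[v - w](subrKA u) nrmD. Qed.

Lemma nrmZ (c : R[i]) v : nrm (c *: v) = complex.Re `|c| * nrm v.
Proof.
apply: (@complexI R); rewrite rmorphM/= -!nrmE normrZ.
by congr (_ * _); rewrite RRe_real// normr_real.
Qed.

Lemma nrmZ1 (c : R[i]) v : `|c| = 1 -> nrm (c *: v) = nrm v.
Proof. by move=> c1; rewrite nrmZ c1 mul1r. Qed.

Lemma nrmZr (x : R) v : nrm (x%:C *: v) = `|x| * nrm v.
Proof. by rewrite nrmZ normc_def/= expr0n/= addr0 sqrtr_sqr. Qed.

Lemma nrm_sum (I : Type) (r : seq I) (P : pred I) (F : I -> V) :
  nrm (\sum_(i <- r | P i) F i) <= \sum_(i <- r | P i) nrm (F i).
Proof.
elim/big_ind2 : _ => [|x v y w xv yw|//]; first by rewrite nrm0.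
by rewrite (le_trans (nrmD _ _))// lerD.
Qed.

Lemma nrm_le_eps v (C : R) : 0 <= C ->
  (forall e : R, 0 < e -> nrm v <= C * e) -> v = 0.
Proof.
move=> C0 h; apply: nrm_eq0; apply/eqP; rewrite eq_le nrm_ge0 andbT.
apply/ler_addgt0Pl => e e0; rewrite addr0.
have C1 : 0 < C + 1 by lra.
apply: le_trans (h (e / (C + 1)) (divr_gt0 e0 C1)) _.
by rewrite mulrCA ger_pMr// ler_pdivrMr//; lra.
Qed.

Lemma ltcR0 (e : R[i]) : 0 < e -> exists2 r : R, 0 < r & e = r%:C.
Proof.
rewrite ltcE/= => /andP[/eqP ie re]; exists (complex.Re e) => //.
by case: e ie re => a b /= ->.
Qed.

Lemma cvg_nrmP (u : nat -> V) (l : V) :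
  u @ \oo --> l <->
  forall e : R, 0 < e -> exists N, forall n, (N <= n)%N -> nrm (u n - l) < e.
Proof.
split=> [/cvgrPdist_lt ul e e0|h].
  have [|N _ hN] := ul e%:C; first by rewrite ltcR.
  by exists N => n /hN /=; rewrite nrmE ltcR nrm_distC.
apply/cvgrPdist_lt => e /ltcR0[r r0 ->]; have [N hN] := h _ r0.
by exists N => // n /= /hN; rewrite nrmE ltcR nrm_distC.
Qed.

Lemma cvg_nrm_uniq (u : nat -> V) (l l' : V) :
  u @ \oo --> l -> u @ \oo --> l' -> l = l'.
Proof. by move=> ul ul'; apply: (cvg_unique _ ul ul'). Qed.

Lemma closure_nrmP (S : set V) (v : V) :
  closure S v <-> forall e : R, 0 < e -> exists2 s, S s & nrm (v - s) < e.
Proof.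
split=> [cl e e0|h B /nbhs_ballP[e /ltcR0[r r0 ->]] hB].
  have [|s [Ss]] := cl (ball v e%:C); first by apply: nbhsx_ballx; rewrite ltcR.
  by rewrite -ball_normE/= nrmE ltcR => ?; exists s.
have [s Ss sv] := h r r0; exists s; split=> //; apply: hB.
by rewrite -ball_normE/= nrmE ltcR.
Qed.

End RealNorm.

Lemma cauchy_nrm (R : realType) (V : completeNormedModType R[i])
    (u : nat -> V) :
  (forall e : R, 0 < e -> exists N, forall n, (N <= n)%N -> nrm (u n - u N) < e) ->
  exists l : V, u @ \oo --> l.
Proof.
move=> h; suff /cauchy_cvgP ul : cauchy (u @ \oo) by exists (lim (u @ \oo)).
apply/cauchyP => e /ltcR0[r r0 ->]; have [N hN] := h r r0.
by exists (u N); exists N => // n /= /hN;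
  rewrite -ball_normE/= nrmE ltcR nrm_distC.
Qed.

(** * Closed sets and the contraction principle *)

Section ClosedSets.
Variables (R : realType) (V : completeNormedModType R[i]).

Lemma closed_nrmP (S : set V) : closed S <->
  forall v, (forall e : R, 0 < e -> exists2 s, S s & nrm (v - s) < e) -> S v.
Proof.
rewrite closure_id; split=> [clS v /closure_nrmP|h]; first by rewrite -clS.
by apply/seteqP; split=> [|v /closure_nrmP/h//]; exact: subset_closure.
Qed.

Lemma closed_cvg_nrm (S : set V) (u : nat -> V) (l : V) :
  closed S -> (forall n, S (u n)) -> u @ \oo --> l -> S l.
Proof.
move=> /closed_nrmP clS Su /cvg_nrmP ul; apply: clS => e /ul[N hN].
by exists (u N) => //; rewrite nrm_distC hN.
Qed.

(** The last clause holds because u is the limit of the iterates from [v0]. It is an induction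
    principle: for square roots it yields self-adjointness, commutation and membership in A^0. *)
Lemma closed_contraction_fixpoint (D : set V) (F : V -> V) (q : R) (v0 : V) :
  0 <= q -> q < 1 -> D v0 -> (forall v, D v -> D (F v)) -> closed D ->
  (forall v w, D v -> D w -> nrm (F v - F w) <= q * nrm (v - w)) ->
  exists2 u, F u = u &
    forall S : set V, closed S -> S v0 -> (forall v, S v -> S (F v)) -> S u.
Proof.
move=> q0 q1 Dv0 DF clD lip.
pose u n := iter n F v0.
have Du n : D (u n) by elim: n => //= n /DF.
pose d := nrm (u 1%N - u 0%N).
have d0 : 0 <= d by exact: nrm_ge0.
have p1 : 0 < 1 - q by rewrite subr_gt0.
have step n : nrm (u n.+1 - u n) <= q ^+ n * d.
  elim: n => [|n IH]; first by rewrite mul1r.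
  have := lip _ _ (Du n.+1) (Du n); move/le_trans; apply.
  by rewrite exprS -mulrA ler_wpM2l.
have dist n m : nrm (u (n + m)%N - u n) * (1 - q) <= q ^+ n * d.
  (* The factor [1 - q ^+ m], from the finite geometric sum, makes the induction on m close. *)
  suff h : nrm (u (n + m)%N - u n) * (1 - q) <= q ^+ n * d * (1 - q ^+ m).
    apply: (le_trans h); apply: ler_piMr; first by rewrite mulr_ge0 ?exprn_ge0.
    by rewrite gerBl exprn_ge0.
  elim: m => [|m IH]; first by rewrite addn0 subrr nrm0 mul0r expr0 subrr mulr0.
  have := nrm_triangle (u (n + m)%N) (u (n + m.+1)%N) (u n).
  have := step (n + m)%N; rewrite -addnS exprD exprS; move: IH p1 d0.
  have := exprn_ge0 n q0; have := exprn_ge0 m q0.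
  set x := nrm _; set y := nrm _; set z := q ^+ n; set t := q ^+ m; set w := nrm _.
  move=> t0 z0 IH p1 _ ys wxy; have := ler_wpM2r (ltW p1) wxy.
  by have := ler_wpM2r (ltW p1) ys; rewrite /= => ? ?; lra.
have [l ul] : exists l : V, u @ \oo --> l.
  apply: cauchy_nrm => e e0.
  have /cvgrPdist_lt/(_ (e * (1 - q) / (d + 1))) : (GRing.exp q : R^nat) @ \oo --> (0 : R).
    by apply: cvg_expr; rewrite ger0_norm.
  have d1 : 0 < d + 1 by lra.
  case=> [|N _ hN]; first by rewrite divr_gt0// mulr_gt0.
  exists N => n Nn; have := hN N (leqnn N); rewrite /= sub0r normrN ger0_norm ?exprn_ge0//.
  rewrite ltr_pdivlMr// => qN; rewrite -(ltr_pM2r p1).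
  have := dist N (n - N)%N; rewrite subnKC// => /le_lt_trans; apply.
  by apply: le_lt_trans qN; rewrite ler_wpM2l ?exprn_ge0//; lra.
exists l; last move=> S clS S0 SF.
  have Dl := closed_cvg_nrm clD Du ul.
  apply/eqP; rewrite -subr_eq0; apply/eqP; apply: (@nrm_le_eps _ _ _ 2) => // e e0.
  move/cvg_nrmP : ul => /(_ e e0)[N hN].
  have := nrm_triangle (u N.+1) (F l) l; move/le_trans; apply.
  have := lip _ _ Dl (Du N); have := hN _ (leqnn N); have := hN _ (leqnSn N).
  rewrite (nrm_distC l) /=; have := nrm_ge0 (u N - l); nra.
by apply: (closed_cvg_nrm clS _ ul) => n; elim: n => //= n /SF.
Qed.

End ClosedSets.

(** * Square roots and positivity in C*-algebras *)

Section Lipschitz.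
Variables (R : realType).

Definition nrm_lipschitz (V W : normedModType R[i]) (f : V -> W) : Prop :=
  exists2 C : R, 0 <= C & forall v w, nrm (f v - f w) <= C * nrm (v - w).

Lemma lip_id (V : normedModType R[i]) : nrm_lipschitz (@id V).
Proof. by exists 1 => // v w; rewrite mul1r. Qed.

Lemma lip_comp (U V W : normedModType R[i]) (f : V -> W) (g : U -> V) :
  nrm_lipschitz f -> nrm_lipschitz g -> nrm_lipschitz (f \o g).
Proof.
move=> [C C0 lf] [D D0 lg]; exists (C * D) => [|v w]; first exact: mulr_ge0.
by apply: (le_trans (lf _ _)); rewrite -mulrA ler_wpM2l.
Qed.

Lemma lip_linear (V W : normedModType R[i]) (f : V -> W) (C : R) : 0 <= C ->
  linear f -> (forall v, nrm (f v) <= C * nrm v) -> nrm_lipschitz f.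
Proof.
move=> C0 lf bf; exists C => // v w; have := lf (-1) w v.
by rewrite !scaleN1r (addrC (- w)) (addrC (- f w)) => <-; exact: bf.
Qed.

Lemma lipZ (V W : normedModType R[i]) (c : R[i]) (f : V -> W) :
  nrm_lipschitz f -> nrm_lipschitz (fun v => c *: f v).
Proof.
move=> [C C0 lf]; exists (complex.Re `|c| * C) => [|v w].
  by rewrite mulr_ge0//; have := normr_ge0 c; rewrite lecE => /andP[].
by rewrite -scalerBr nrmZ -mulrA ler_wpM2l//;
  have := normr_ge0 c; rewrite lecE => /andP[].
Qed.

(** Equalizers supply closed sets for the fixed-point principle; they also carry identities from a
    dense subspace to the whole algebra. *)
Lemma closed_lip_eq (V : completeNormedModType R[i]) (W : normedModType R[i])
    (f g : V -> W) : nrm_lipschitz f -> nrm_lipschitz g ->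
  closed [set v | f v = g v].
Proof.
move=> [C C0 lf] [D D0 lg]; apply/closed_nrmP => v h /=.
apply/eqP; rewrite -subr_eq0; apply/eqP.
apply: (@nrm_le_eps _ _ _ (C + D)) => [|e /h[s /= fg vs]]; first exact: addr_ge0.
apply: (le_trans (nrm_triangle (f s) _ _)); rewrite {2}fg mulrDl lerD//.
  by apply: le_trans (lf _ _) _; rewrite ler_wpM2l// ltW.
by apply: le_trans (lg _ _) _; rewrite ler_wpM2l// nrm_distC ltW.
Qed.

Lemma closed_nrm_le (V : completeNormedModType R[i]) (r : R) :
  closed [set v : V | nrm v <= r].
Proof.
apply/closed_nrmP => v h /=; apply/ler_addgt0Pl => e /h[s /= sr vs].
by rewrite -[v](subrK s) (le_trans (nrmD _ _))// lerD// ltW.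
Qed.

End Lipschitz.

Section StarAlgebraTheory.
Variables (K : numClosedFieldType) (B : starAlgType K).
Implicit Types a b : B.

Lemma star0 : star 0 = 0 :> B.
Proof. by apply: (addIr (star 0)); rewrite -starD !add0r. Qed.

Lemma starN a : star (- a) = - star a.
Proof. by apply: (addIr (star a)); rewrite -starD !addNr star0. Qed.

Lemma starB a b : star (a - b) = star a - star b.
Proof. by rewrite starD starN. Qed.

Lemma star1 : star 1 = 1 :> B.
Proof. by rewrite -[LHS]mulr1 -{2}[1]starK -starM mulr1 starK. Qed.

Lemma star_sum (I : Type) (r : seq I) (P : pred I) (F : I -> B) :
  star (\sum_(i <- r | P i) F i) = \sum_(i <- r | P i) star (F i).
Proof. exact: (big_morph _ starD star0). Qed.

End StarAlgebraTheory.

Section CStar.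
Variables (R : realType) (A : cstarAlgType R[i]).
Implicit Types a b h k : A.

Lemma nrmM a b : nrm (a * b) <= nrm a * nrm b.
Proof. by rewrite -lecR rmorphM/= -!nrmE ler_cstar_normM. Qed.

Lemma nrm_starM a : nrm (star a * a) = nrm a ^+ 2.
Proof. by apply: (@complexI R); rewrite rmorphXn/= -!nrmE cstar_norm_starM. Qed.

Lemma nrm_star a : nrm (star a) = nrm a.
Proof.
suff h b : nrm b <= nrm (star b) by apply/le_anti; rewrite h -{2}[a]starK h.
have := nrmM (star b) b; rewrite nrm_starM => h.
have [->|b0] := eqVneq (nrm b) 0; first exact: nrm_ge0.
have bp : 0 < nrm b by rewrite lt_def b0 nrm_ge0.
by rewrite -(ler_pM2r bp) -expr2.
Qed.

Lemma nrm1 : nrm (1 : A) = 1.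
Proof.
have := nrm_starM 1; rewrite star1 mulr1 => h.
have /eqP : nrm (1 : A) * (nrm (1 : A) - 1) = 0 by rewrite mulrBr mulr1 -expr2 -h subrr.
rewrite mulf_eq0 subr_eq0 => /orP[/eqP/nrm_eq0/eqP|/eqP//].
by rewrite oner_eq0.
Qed.

Lemma star_scaler (x : R) a : star (x%:C *: a) = x%:C *: star a.
Proof. by rewrite starZ; congr (_ *: _); apply/CrealP; rewrite complex_real. Qed.

Lemma lip_star : nrm_lipschitz (@star _ A).
Proof. by exists 1 => // a b; rewrite mul1r -starB nrm_star. Qed.

Lemma lip_mull a : nrm_lipschitz (fun b : A => a * b).
Proof.
by exists (nrm a) => [|b c]; [exact: nrm_ge0|rewrite -mulrBr nrmM].
Qed.

Lemma lip_mulr a : nrm_lipschitz (fun b : A => b * a).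
Proof.
by exists (nrm a) => [|b c]; [exact: nrm_ge0|rewrite -mulrBl (le_trans (nrmM _ _))// mulrC].
Qed.

(* k = 1 - u, where u is the fixed point of the contraction u |-> (h + u^2)/2
   of a ball of radius less than 1. *)
Lemma cstar_sqrt_one_sub h : nrm h < 1 ->
  exists2 k, k * k = 1 - h &
    forall S : set A, closed S -> S 0 ->
      (forall a, S a -> S (2^-1%:C *: (h + a * a))) -> S (1 - k).
Proof.
move=> h1; have h0 := nrm_ge0 h.
(* Since |h| = 2r - 1 and r < 1, F maps the ball of radius r to itself: (2r - 1 + r^2) / 2 <= r. On
   this ball F is Lipschitz with constant r. *)
pose r : R := (1 + nrm h) / 2.
pose F a : A := 2^-1%:C *: (h + a * a).
have half : `|2^-1 : R| = 2^-1 by rewrite ger0_norm.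
have [||||||u Fu uS] := @closed_contraction_fixpoint _ A [set a | nrm a <= r] F r 0.
- by rewrite /r; lra.
- by rewrite /r; lra.
- by rewrite /= nrm0 /r; lra.
- move=> a /= ar; rewrite nrmZr half; have a0 := nrm_ge0 a.
  have := nrmD h (a * a); have := nrmM a a; have : nrm a * nrm a <= r * r by nra.
  rewrite /r; nra.
- exact: closed_nrm_le.
- move=> a b /= ar br; rewrite -scalerBr nrmZr half opprD addrACA subrr add0r.
  have -> : a * a - b * b = a * (a - b) + (a - b) * b.
    by rewrite mulrBr mulrBl addrA subrK.
  have := nrmD (a * (a - b)) ((a - b) * b).
  have := nrmM a (a - b); have := nrmM (a - b) b; have := nrm_ge0 (a - b).
  nra.
exists (1 - u) => [|S clS S0 SF]; last by rewrite opprB addrC subrK; exact: uS.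
have hu : h + u * u = u + u.
  rewrite -{3 4}Fu /F -scalerDl -rmorphD/= -[LHS]scale1r.
  by congr (_ *: _); rewrite -(rmorph1 (real_complex R)); congr (_%:C); lra.
have -> : h = u + u - u * u by rewrite -hu addrK.
by rewrite mulrBl !mulrBr !mul1r mulr1 !opprB opprD -addrA (addrCA (- u)).
Qed.

End CStar.

Section SelfAdjoint.
Variables (R : realType) (A : cstarAlgType R[i]).
Implicit Types a b h k x y : A.

(** The self-adjoint elements and the commutant of x are closed, contain 0 and are stable under a
    |-> (h + a^2) / 2, so both contain the fixed point. *)
Lemma cstar_selfadjoint_sqrt h : star h = h -> nrm h < 1 ->
  exists k, [/\ star k = k, k * k = 1 - h & forall x, x * h = h * x -> x * k = k * x].
Proof.
move=> sh h1; have [k kk kS] := cstar_sqrt_one_sub h1; exists k; split=> //.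
  have : star (1 - k) = 1 - k.
    apply: (kS [set a | star a = a]) => [||a /= sa]; last first.
    - by rewrite star_scaler starD starM sh sa.
    - exact: star0.
    - exact: (closed_lip_eq (@lip_star _ A) (@lip_id _ A)).
  by rewrite starB star1 => /addrI/oppr_inj.
move=> x xh; have : x * (1 - k) = (1 - k) * x.
  apply: (kS [set a | x * a = a * x]) => [||a /= sa]; last first.
  - by rewrite -scalerAl -scalerAr mulrDr mulrDl xh mulrA sa -mulrA sa mulrA.
  - by rewrite /= mulr0 mul0r.
  - exact: (closed_lip_eq (lip_mull x) (lip_mulr x)).
by rewrite mulrBr mulrBl mulr1 mul1r => /addrI/oppr_inj.
Qed.

(* h + i k is then unitary. *)
Lemma cstar_sqr_sum_one h k : star h = h -> star k = k -> h * k = k * h ->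
  h * h + k * k = 1 -> nrm h <= 1.
Proof.
move=> sh sk hk hk1; pose u := h + 'i%C *: k.
have su : star u = h - 'i%C *: k.
  rewrite /u starD starZ sh sk -scaleNr; congr (_ + _ *: _).
  by apply/eqP; rewrite eq_complex /= oppr0 !eqxx.
have nu : nrm u = 1.
  have : star u * u = 1.
    rewrite su /u mulrBl !mulrDr -!scalerAl -!scalerAr scalerA hk.
    have -> : 'i%C * 'i%C = -1 :> R[i] by rewrite -expr2 sqr_i.
    by rewrite scaleN1r opprD opprK addrA addrK.
  by move=> /(congr1 (@nrm _ A)); rewrite nrm_starM nrm1 => /eqP;
    rewrite sqrp_eq1 ?nrm_ge0// => /eqP.
have : h + h = u + star u by rewrite su /u addrACA subrr addr0.
have -> : h + h = 2%:C *: h.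
  by rewrite -[2]/(1 + 1) rmorphD/= scalerDl scale1r.
move=> /(congr1 (@nrm _ A)); rewrite nrmZr ger0_norm// => h2.
by have := nrmD u (star u); rewrite -h2 nrm_star nu; lra.
Qed.

End SelfAdjoint.

(** * Contractivity of star-homomorphisms and positivity of squares *)

Section Contractivity.
Variables (R : realType) (A : cstarAlgType R[i]).
Implicit Types a b h k x y : A.

(** For self-adjoint h with |h| < 1, let k be a square root of 1 - h^2. The relation h^2 + k^2 = 1
    is algebraic, so f preserves it, and it bounds |f h| by 1. Scaling gives all self-adjoint
    elements, and [star a * a] gives all a. *)
Lemma starhom_contractive (B : cstarAlgType R[i]) (f : A -> B) :
  linear f -> {morph f : a b / a * b} -> {morph f : a / star a} -> f 1 = 1 ->
  forall a, nrm (f a) <= nrm a.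
Proof.
move=> lf fM fS f1.
have f0 : f 0 = 0.
  by have := lf (-1) 0 0; rewrite scaler0 add0r scaleN1r addNr.
have fZ c a : f (c *: a) = c *: f a by have := lf c a 0; rewrite !addr0 f0 addr0.
have fD a b : f (a + b) = f a + f b by have := lf 1 a b; rewrite !scale1r.
have sa1 h : star h = h -> nrm h < 1 -> nrm (f h) <= 1.
  move=> sh h1.
  have [||k [sk kk hk]] := cstar_selfadjoint_sqrt (h := h * h).
  - by rewrite starM sh.
  - by apply: le_lt_trans (nrmM _ _) _; have := nrm_ge0 h; nra.
  have {}hk : h * k = k * h by apply: hk; rewrite mulrA.
  apply: (cstar_sqr_sum_one (h := f h) (k := f k)).
  - by rewrite -fS sh.
  - by rewrite -fS sk.
  - by rewrite -!fM hk.
  - by rewrite -!fM -fD kk addrC subrK.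
have sa h : star h = h -> nrm (f h) <= nrm h.
  move=> sh; apply/ler_addgt0Pl => e e0; have h0 := nrm_ge0 h.
  have c0 : 0 < e + nrm h by lra.
  have := @sa1 ((e + nrm h)^-1%:C *: h); rewrite fZ !nrmZr star_scaler sh.
  rewrite ger0_norm ?invr_ge0 ?(ltW c0)// !(mulrC _^-1) ltr_pdivrMr// ler_pdivrMr// mul1r.
  by apply=> //; lra.
move=> a; have := sa (star a * a); rewrite fM fS nrm_starM nrm_starM starM starK.
by move=> /(_ erefl); rewrite ler_pXn2r// ?nnegrE ?nrm_ge0.
Qed.

(** The norm form of the positivity of x^2: if x = s h and h^2 + k^2 = 1 with |k| <= 1, then s^2 -
    x^2 = s^2 k^2 has norm at most s^2. *)
Lemma selfadjoint_sqr_bound x : star x = x ->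
  exists2 t : R, 0 <= t & nrm (t%:C *: 1 - x * x) <= t.
Proof.
move=> sx; have x0 := nrm_ge0 x; pose s := nrm x + 1.
have s0 : 0 < s by rewrite /s; lra.
exists (s ^+ 2); first by rewrite exprn_ge0// ltW.
pose h := s^-1%:C *: x.
have sh : star h = h by rewrite star_scaler sx.
have h1 : nrm h < 1.
  by rewrite nrmZr ger0_norm ?invr_ge0 ?(ltW s0)// mulrC ltr_pdivrMr// mul1r /s; lra.
have [||k [sk kk hk]] := cstar_selfadjoint_sqrt (h := h * h).
- by rewrite starM sh.
- by apply: le_lt_trans (nrmM _ _) _; have := nrm_ge0 h; nra.
have {}hk : h * k = k * h by apply: hk; rewrite mulrA.
have k1 : nrm k <= 1.
  by apply: (cstar_sqr_sum_one (h := k) (k := h)) => //; rewrite kk subrK.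
have xh : x = s%:C *: h.
  by rewrite scalerA -rmorphM/= divff ?gt_eqF// scale1r.
have -> : (s ^+ 2)%:C *: 1 - x * x = (s ^+ 2)%:C *: (k * k) :> A.
  by rewrite kk xh -scalerAl -scalerAr scalerA scalerBr expr2 rmorphM.
rewrite nrmZr ger0_norm ?exprn_ge0 ?(ltW s0)// ger_pMr ?exprn_gt0//.
by apply: le_trans (nrmM _ _) _; have := nrm_ge0 k; nra.
Qed.

End Contractivity.

(** * Positive functionals in the presence of a norm and square roots *)

Section PositiveFunctional.
Variables (R : realType) (B : starAlgType R[i]) (p : B -> R) (phi : B -> R[i]).
Hypothesis p_ge0 : forall a, 0 <= p a.
Hypothesis pD : forall a b, p (a + b) <= p a + p b.
Hypothesis pZ : forall c a, p (c *: a) = complex.Re `|c| * p a.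
Hypothesis p_star : forall a, p (star a) = p a.
(** The norm is a parameter because two algebras are served: A with its own norm, and A^0, which
    borrows the norm of A. Completeness enters only through this hypothesis. *)
Hypothesis p_sqrt : forall h, star h = h -> p h < 1 ->
  exists2 k, star k = k & k * k = 1 - h.
Hypothesis phi_state : is_state phi.

Let pZr (x : R) a : p (x%:C *: a) = `|x| * p a.
Proof. by rewrite pZ normc_def/= expr0n/= addr0 sqrtr_sqr. Qed.

Let phi_lin : scalar phi. Proof. by case: phi_state. Qed.

Lemma scalar_fun0 (V : lmodType R[i]) (f : V -> R[i]) : scalar f -> f 0 = 0.
Proof. by move=> lf; have := lf (-1) 0 0; rewrite scaler0 add0r mulN1r addNr. Qed.

Lemma scalar_funZ (V : lmodType R[i]) (f : V -> R[i]) c a :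
  scalar f -> f (c *: a) = c * f a.
Proof. by move=> lf; have := lf c a 0; rewrite !addr0 scalar_fun0// addr0. Qed.

Lemma scalar_funD (V : lmodType R[i]) (f : V -> R[i]) a b :
  scalar f -> f (a + b) = f a + f b.
Proof. by move=> lf; have := lf 1 a b; rewrite scale1r mul1r. Qed.

Lemma scalar_funB (V : lmodType R[i]) (f : V -> R[i]) a b :
  scalar f -> f (a - b) = f a - f b.
Proof.
by move=> lf; have := lf (-1) b a; rewrite scaleN1r mulN1r (addrC (- b)) => ->; rewrite addrC.
Qed.

Lemma scalar_fun_sum (V : lmodType R[i]) (f : V -> R[i]) (I : Type) (r : seq I)
    (P : pred I) (F : I -> V) : scalar f ->
  f (\sum_(i <- r | P i) F i) = \sum_(i <- r | P i) f (F i).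
Proof.
by move=> lf; apply: (big_morph f (fun a b => scalar_funD a b lf)); exact: scalar_fun0.
Qed.

Lemma state_ge0_one_sub h : star h = h -> p h < 1 -> 0 <= 1 - phi h.
Proof.
move=> sh /(p_sqrt sh)[k sk kk]; case: phi_state => _ pos phi1.
by rewrite -phi1 -scalar_funB// -kk -{1}sk.
Qed.

(** For c > p h, both 1 - phi h / c and 1 + phi h / c are nonnegative. In the order of R[i] this
    includes being real, so [phi h] is real and lies between -c and c. *)
Lemma state_selfadjoint h : star h = h ->
  exists2 x : R, phi h = x%:C & `|x| <= p h.
Proof.
move=> sh; have key (c : R) : p h < c -> 0 <= 1 - (c^-1)%:C * phi h.
  move=> hc; have c0 : 0 < c by exact: le_lt_trans (p_ge0 h) hc.
  rewrite -scalar_funZ//; apply: state_ge0_one_sub.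
    by rewrite starZ sh; congr (_ *: _); apply/CrealP; rewrite complex_real.
  by rewrite pZr ger0_norm ?invr_ge0 ?(ltW c0)// mulrC ltr_pdivrMr// mul1r.
have key' (c : R) : p h < c -> 0 <= 1 + (c^-1)%:C * phi h.
  move=> hc; have c0 : 0 < c by exact: le_lt_trans (p_ge0 h) hc.
  rewrite -[_ * _]opprK -mulNr -rmorphN/= -scalar_funZ//; apply: state_ge0_one_sub.
    by rewrite starZ sh; congr (_ *: _); apply/CrealP; rewrite complex_real.
  by rewrite pZr normrN ger0_norm ?invr_ge0 ?(ltW c0)// mulrC ltr_pdivrMr// mul1r.
case: (phi h) key key' => x y key key'.
have y0 : y = 0.
  have c0 : 0 < p h + 1 by rewrite (le_lt_trans (p_ge0 h))// ltrDl.
  have := key (p h + 1); rewrite ltrDl => /(_ ltr01).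
  rewrite lecE /= mul0r addr0 sub0r oppr_eq0 => /andP[/eqP + _].
  by move=> /eqP; rewrite mulf_eq0 invr_eq0 gt_eqF//= => /eqP.
exists x; first by rewrite y0.
apply/ler_addgt0Pl => e e0; have c0 : 0 < e + p h.
  by rewrite (le_lt_trans (p_ge0 h))// ltrDr.
have := key (e + p h); have := key' (e + p h); rewrite ltrDr => /(_ e0) + /(_ e0).
rewrite !lecE /= !mul0r !subr0 => /andP[_ h1] /andP[_ h2].
rewrite ler_norml; apply/andP; split.
  move: h1; rewrite addrC -lerBlDr sub0r mulrC ler_pdivlMr// mulN1r; lra.
by move: h2; rewrite subr_ge0 mulrC ler_pdivrMr// mul1r.
Qed.

(** In a = h + i k both self-adjoint parts have norm at most that of a; the constant 2 adds up their
    two bounds. *)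
Lemma state_bounded a : complex.Re `|phi a| <= 2 * p a.
Proof.
pose h := 2^-1%:C *: (a + star a).
pose k := (- 2^-1%:C * 'i%C) *: (a - star a).
have ah : a = h + 'i%C *: k.
  rewrite /h /k scalerA mulrCA -expr2 sqr_i mulrN1 opprK -scalerDr.
  rewrite addrACA subrr addr0 -mulr2n -(scaler_nat 2 a) scalerA.
  by rewrite -(rmorph_nat (real_complex R) 2) -rmorphM/= mulVf ?scale1r.
have cr (x : R) : Num.conj x%:C = x%:C by apply/CrealP; rewrite complex_real.
have sh : star h = h by rewrite /h starZ cr starD starK addrC.
have sk : star k = k.
  rewrite /k starZ rmorphM rmorphN/= cr starB starK -(opprB a) scalerN -scaleNr.
  congr (_ *: _).
  by apply/eqP; rewrite eq_complex /=; apply/andP; split; apply/eqP; ring.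
have p2 (c : R[i]) b : `|c| = 2^-1%:C -> p b <= 2 * p a -> p (c *: b) <= p a.
  by move=> c1 pb; rewrite pZ c1/=; lra.
have ph : p h <= p a.
  by apply: p2; [rewrite ger0_norm// lecR|have := pD a (star a); rewrite p_star; lra].
have pk : p k <= p a.
  apply: p2.
    rewrite normrM normrN normc_def normc_def/= !expr0n/= !addr0 add0r expr1n sqrtr1 mulr1.
    by rewrite sqrtr_sqr ger0_norm.
  have := pD a (- star a); rewrite -scaleN1r pZ normrN1/= mul1r p_star; lra.
have [x hx xp] := state_selfadjoint sh; have [y ky yp] := state_selfadjoint sk.
have -> : phi a = x%:C + 'i%C * y%:C.
  by rewrite {1}ah scalar_funD// (scalar_funZ _ k)// hx ky.
rewrite -lecR RRe_real ?normr_real//; apply: le_trans (ler_normD _ _) _.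
rewrite normrM !normc_def/= !expr0n/= !addr0 add0r expr1n sqrtr1 mul1r !sqrtr_sqr.
by rewrite -rmorphD/= lecR; lra.
Qed.

(** For e > 0 the element (t - h) / (t + e) has norm less than 1, so phi is at most 1 on it. This
    reads t - phi h <= t + e, and e is arbitrary. *)
Lemma state_ge0 h (t : R) : star h = h -> 0 <= t -> p (t%:C *: 1 - h) <= t ->
  0 <= phi h.
Proof.
move=> sh t0 pt; have [x hx _] := state_selfadjoint sh.
rewrite hx ler0c; apply/ler_addgt0Pl => e e0.
have c0 : 0 < t + e by lra.
have sr (y : R) b : star b = b -> star (y%:C *: b) = y%:C *: b.
  by move=> sb; rewrite starZ sb; congr (_ *: _); apply/CrealP; rewrite complex_real.
have := @state_ge0_one_sub ((t + e)^-1%:C *: (t%:C *: 1 - h)).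
rewrite sr; last by rewrite starB sr ?star1// sh.
rewrite pZr ger0_norm ?invr_ge0 ?(ltW c0)// mulrC ltr_pdivrMr// => /(_ erefl).
rewrite (scalar_funZ _ _ phi_lin) (scalar_funB _ _ phi_lin) (scalar_funZ _ _ phi_lin) hx; case: phi_state => _ _ ->.
rewrite mulr1 -rmorphB -rmorphM/= -(rmorph1 (real_complex R)) -rmorphB/= ler0c.
rewrite subr_ge0 mul1r mulrC ler_pdivrMr// mul1r => h1.
by have : t - x <= t + e; [apply: h1; lra|lra].
Qed.

End PositiveFunctional.

(** * Averages over the circle *)

Section ComplexModulus.
Variable R : realType.
Implicit Types (z w : R[i]) (s t : R).

Definition cabs z : R := complex.Re `|z|.

Lemma cabsE z : `|z| = (cabs z)%:C.
Proof. by rewrite RRe_real// normr_real. Qed.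

Lemma cabs_ge0 z : 0 <= cabs z.
Proof. by have := normr_ge0 z; rewrite cabsE ler0c. Qed.

Lemma cabsD z w : cabs (z + w) <= cabs z + cabs w.
Proof. by rewrite -lecR rmorphD/= -!cabsE ler_normD. Qed.

Lemma cabsM z w : cabs (z * w) = cabs z * cabs w.
Proof. by apply: (@complexI R); rewrite rmorphM/= -!cabsE normrM. Qed.

Lemma cabsr s : cabs s%:C = `|s|.
Proof. by rewrite /cabs normc_def/= expr0n/= addr0 sqrtr_sqr. Qed.

Lemma cabs_le z : cabs z <= `|complex.Re z| + `|complex.Im z|.
Proof.
rewrite [in leLHS](complexE z); apply: le_trans (cabsD _ _) _.
by rewrite cabsM !cabsr /cabs normc_def/= expr0n/= add0r expr1n sqrtr1 mul1r.
Qed.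

Lemma cabs_unit z : `|z| = 1 -> cabs z = 1.
Proof. by rewrite /cabs => ->. Qed.

Lemma derive_lipschitz (f df : R -> R) (C : R) :
  (forall x : R, is_derive x (1 : R) f (df x)) -> (forall x, `|df x| <= C) ->
  forall s t, `|f s - f t| <= C * `|s - t|.
Proof.
move=> fd dC s t; wlog st : s t / s <= t => [h|].
  by have /orP[/h//|/h] := le_total s t; rewrite distrC (distrC t).
have cf : {within `[s, t], continuous f}.
  apply: continuous_subspaceT => x; apply/differentiable_continuous.
  by rewrite -derivable1_diffP; case: (fd x).
have [c _ fc] := MVT_segment st (fun x _ => fd x) cf.
by rewrite distrC (distrC s) fc normrM ler_wpM2r// dC.
Qed.

End ComplexModulus.

Section Expi.
Variable R : realType.
Implicit Types (s t : R).

Lemma expiD s t : expi (s + t) = expi s * expi t.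
Proof.
apply/eqP; rewrite eq_complex /= cosD sinD eqxx/=.
by apply/eqP; ring.
Qed.

Lemma expi0 : expi (0 : R) = 1.
Proof. by rewrite /expi cos0 sin0. Qed.

Lemma norm_expi t : `|expi t| = 1.
Proof. by rewrite normc_def/= cos2Dsin2 sqrtr1. Qed.

Lemma expi_mulrn t n : expi (t *+ n) = expi t ^+ n.
Proof. by elim: n => [|n IH]; rewrite ?expi0// mulrS expiD IH exprS. Qed.

Lemma expiN t : expi (- t) = (expi t)^-1.
Proof.
apply: (mulIf (x := expi t)); first by rewrite -normr_gt0 norm_expi.
by rewrite -expiD addNr expi0 mulVf// -normr_gt0 norm_expi.
Qed.

Lemma expi_mulrz t (k : int) : expi (t *~ k) = expi t ^ k.
Proof. by case: k => n; rewrite ?NegzE ?mulrNz ?expiN -pmulrn expi_mulrn -?exprnN. Qed.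

Lemma expi_2pi : expi (2 * pi : R) = 1.
Proof. by rewrite mulr_natl /expi cos2pi sin2pi. Qed.

Lemma expi_pi : expi (pi : R) = -1.
Proof. by apply/eqP; rewrite eq_complex/= cospi sinpi oppr0 !eqxx. Qed.

Lemma cabs_expi_dist s t : cabs (expi s - expi t) <= 2 * `|s - t|.
Proof.
apply: le_trans (cabs_le _) _; rewrite /= mulr_natl mulr2n lerD//.
- rewrite -[leRHS]mul1r; apply: (@derive_lipschitz R cos (fun x => - sin x)) => x.
  by rewrite normrN sin_max.
- rewrite -[leRHS]mul1r; apply: (@derive_lipschitz R sin cos) => x.
  exact: cos_max.
Qed.

(** The sign of t lets [dyadic_avg_rot] split off a natural multiple of [dyadic_angle n]; hence the
    angle 2 pi - acos x on the lower half of the circle. *)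
Lemma expi_surj (z : R[i]) : `|z| = 1 -> exists2 t, 0 <= t & z = expi t.
Proof.
move=> z1; have : complex.Re z ^+ 2 + complex.Im z ^+ 2 = 1.
  by apply: (@complexI R); rewrite add_Re2_Im2 z1 expr1n.
case: z z1 => x y _ /= xy1.
have x1 : -1 <= x <= 1 by apply/andP; split; have := sqr_ge0 y; nra.
have sx : sin (acos x) = `|y|.
  by rewrite sin_acos// -xy1 (addrC (x ^+ 2)) addrK sqrtr_sqr.
have cx : cos (acos x) = x by rewrite acosK// in_itv.
have [y0|y0] := leP 0 y.
  exists (acos x); first exact: acos_ge0.
  by rewrite /expi cx sx ger0_norm.
exists (2 * pi - acos x).
  by have := acos_lepi x1; have := pi_ge0 R; lra.
by rewrite expiD expi_2pi mul1r /expi cosN sinN cx sx ltr0_norm// opprK.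
Qed.

End Expi.

Section DyadicAverage.
Variable R : realType.

Definition dyadic_angle (n : nat) : R := 2 * pi / 2 ^+ n.
Local Notation theta := dyadic_angle.
Local Notation zeta n := (expi (theta n)).

Lemma dyadic_angle_gt0 n : 0 < theta n.
Proof. by rewrite divr_gt0 ?exprn_gt0// mulr_gt0// pi_gt0. Qed.

Lemma dyadic_angleS n : theta n.+1 + theta n.+1 = theta n.
Proof.
rewrite /theta exprS; have : (2 : R) ^+ n != 0 by rewrite expf_neq0.
by move=> h; field.
Qed.

Lemma dyadic_angle_small (e : R) : 0 < e -> exists n, theta n <= e.
Proof.
move=> e0; exists (Num.truncn (2 * pi / e)).+1.
rewrite ler_pdivrMr ?exprn_gt0// (mulrC e) -ler_pdivrMr//.
apply: (le_trans (ltW (truncnS_gt _))).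
by rewrite -natrX ler_nat ltnW// ltn_expl.
Qed.

Lemma dyadic_angle_le m n : (m <= n)%N -> theta n <= theta m.
Proof.
move=> mn; rewrite -(subnKC mn); elim: (n - m)%N => [|k IH]; first by rewrite addn0.
by apply: le_trans IH; rewrite addnS -[leRHS]dyadic_angleS lerDl ltW// dyadic_angle_gt0.
Qed.

Lemma zetaS n : zeta n.+1 * zeta n.+1 = zeta n.
Proof. by rewrite -expiD dyadic_angleS. Qed.

Lemma zeta0 : zeta 0 = 1.
Proof. by rewrite /theta expr0 divr1 expi_2pi. Qed.

(* The mean of f over the 2^n-th roots of unity. *)
Fixpoint dyadic_avg (V : lmodType R[i]) (n : nat) (f : R[i] -> V) : V :=
  if n is m.+1 then
    dyadic_avg m (fun z => 2^-1%:C *: (f z + f (zeta n * z)))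
  else f 1.

Section Algebra.
Variables (V W : lmodType R[i]).
Implicit Types (f g : R[i] -> V) (n : nat).

Lemma dyadic_avg_linear n c f g :
  dyadic_avg n (fun z => c *: f z + g z) = c *: dyadic_avg n f + dyadic_avg n g.
Proof.
elim: n f g => //= n IH f g; rewrite -IH; congr (dyadic_avg n _).
apply/funext => z; rewrite !scalerDr !scalerA (mulrC c) !addrA; congr (_ + _).
by rewrite -!addrA; congr (_ + _); rewrite addrC.
Qed.

Lemma dyadic_avg_cst n (v : V) : dyadic_avg n (fun=> v) = v.
Proof.
elim: n => //= n IH; rewrite -[in RHS]IH; congr (dyadic_avg n _).
apply/funext => _; rewrite -mulr2n -(scaler_nat 2 v) scalerA.
by rewrite -(rmorph_nat (real_complex R) 2) -rmorphM/= mulVf ?scale1r.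
Qed.

Lemma eq_dyadic_avg n f g : (forall z, `|z| = 1 -> f z = g z) ->
  dyadic_avg n f = dyadic_avg n g.
Proof.
elim: n f g => [|n IH] f g fg /=; first by rewrite fg ?normr1.
by apply: IH => z z1; rewrite !fg// normrM norm_expi mul1r.
Qed.

Lemma dyadic_avg0 n : dyadic_avg n (fun=> 0 : V) = 0.
Proof. exact: dyadic_avg_cst. Qed.

Lemma dyadic_avgD n f g :
  dyadic_avg n (fun z => f z + g z) = dyadic_avg n f + dyadic_avg n g.
Proof.
rewrite -[dyadic_avg n f]scale1r -dyadic_avg_linear.
by congr dyadic_avg; apply/funext => z; rewrite scale1r.
Qed.

Lemma dyadic_avgZ n c f :
  dyadic_avg n (fun z => c *: f z) = c *: dyadic_avg n f.
Proof.
rewrite -[RHS]addr0 -[in RHS](dyadic_avg0 n) -dyadic_avg_linear.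
by congr dyadic_avg; apply/funext => z; rewrite addr0.
Qed.

Lemma dyadic_avgB n f g :
  dyadic_avg n (fun z => f z - g z) = dyadic_avg n f - dyadic_avg n g.
Proof.
by rewrite dyadic_avgD; congr (_ + _); rewrite -scaleN1r -dyadic_avgZ;
  congr dyadic_avg; apply/funext => z; rewrite scaleN1r.
Qed.

Lemma dyadic_avg_sum n (I : Type) (r : seq I) (F : I -> R[i] -> V) :
  dyadic_avg n (fun z => \sum_(i <- r) F i z) = \sum_(i <- r) dyadic_avg n (F i).
Proof.
elim: r => [|i r IH].
  by rewrite big_nil -[RHS](dyadic_avg0 n); congr dyadic_avg;
    apply/funext => z; rewrite big_nil.
by rewrite big_cons -IH -dyadic_avgD; congr dyadic_avg; apply/funext => z;
  rewrite big_cons.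
Qed.

Lemma dyadic_avg_morph n (h : V -> W) f : linear h ->
  h (dyadic_avg n f) = dyadic_avg n (h \o f).
Proof.
move=> lh; have h0 : h 0 = 0.
  by have := lh (-1) 0 0; rewrite scaler0 add0r scaleN1r addNr.
have hZ c v : h (c *: v) = c *: h v by have := lh c v 0; rewrite !addr0 h0 addr0.
have hD v w : h (v + w) = h v + h w by have := lh 1 v w; rewrite !scale1r.
elim: n f => //= n IH f; rewrite IH; congr dyadic_avg.
by apply/funext => z /=; rewrite hZ hD.
Qed.

(** Replacing z by zeta_(n+1) z exchanges the two terms averaged at level n + 1, up to the factor
    zeta_(n+1)^2 = zeta_n, which the induction hypothesis absorbs. *)
Lemma dyadic_avg_zeta n f :
  dyadic_avg n (fun z => f (zeta n * z)) = dyadic_avg n f.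
Proof.
elim: n f => [|n IH] f; first by rewrite /= zeta0 mul1r.
rewrite /= 2!dyadic_avgZ 2!dyadic_avgD; congr (_ *: _); rewrite addrC; congr (_ + _).
by rewrite -[RHS]IH; congr dyadic_avg; apply/funext => z; rewrite mulrA zetaS.
Qed.

Lemma dyadic_avg_zetaX n j f :
  dyadic_avg n (fun z => f (zeta n ^+ j * z)) = dyadic_avg n f.
Proof.
elim: j => [|j IH]; first by congr dyadic_avg; apply/funext => z; rewrite mul1r.
rewrite -IH -[RHS]dyadic_avg_zeta; congr dyadic_avg; apply/funext => z.
by rewrite exprSr mulrA.
Qed.

End Algebra.
End DyadicAverage.

(** * Existence and rotation invariance of the mean over the circle *)

Section CircleMean.
Variables (R : realType) (V : completeNormedModType R[i]).
Local Notation theta := (@dyadic_angle R).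
Local Notation zeta n := (expi (theta n)).
Implicit Types (f g : R[i] -> V) (n m : nat).

Lemma nrm_dyadic_avg_le n f (w : R[i] -> R) :
  (forall z, `|z| = 1 -> nrm (f z) <= w z) ->
  (nrm (dyadic_avg n f))%:C <= dyadic_avg n (fun z => (w z)%:C : R[i]^o).
Proof.
elim: n f w => [|n IH] f w fw /=; first by rewrite lecR fw ?normr1.
have -> : (fun z => 2^-1%:C *: ((w z)%:C + (w (zeta n.+1 * z))%:C : R[i]^o)) =
    (fun z => (2^-1 * (w z + w (zeta n.+1 * z)))%:C).
  by apply/funext => z; rewrite rmorphM/= rmorphD.
apply: IH => z z1; rewrite nrmZr ger0_norm// ler_wpM2l//.
by apply: le_trans (nrmD _ _) _; rewrite lerD ?fw// normrM norm_expi mul1r.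
Qed.

Lemma nrm_dyadic_avg_cst n f (C : R) :
  (forall z, `|z| = 1 -> nrm (f z) <= C) -> nrm (dyadic_avg n f) <= C.
Proof.
by move=> fC; have := nrm_dyadic_avg_le n fC; rewrite dyadic_avg_cst lecR.
Qed.

Lemma nrm_dyadic_avgB n f g (C : R) :
  (forall z, `|z| = 1 -> nrm (f z - g z) <= C) ->
  nrm (dyadic_avg n f - dyadic_avg n g) <= C.
Proof. by move=> fC; rewrite -dyadic_avgB; exact: nrm_dyadic_avg_cst. Qed.

(* A 2^(n+m)-th root of unity is a 2^n-th root of unity times some expi s, with
   s as in the hypothesis. *)
Lemma dyadic_avg_refine n m f g (C : R) :
  (forall s z, 0 <= s <= theta n - theta (n + m) -> `|z| = 1 ->
     nrm (f (expi s * z) - g z) <= C) ->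
  nrm (dyadic_avg (n + m) f - dyadic_avg n g) <= C.
Proof.
elim: m f => [|m IH] f h.
  rewrite addn0; apply: nrm_dyadic_avgB => z z1.
  by have := h 0 z; rewrite expi0 mul1r addn0 subrr lexx; apply.
rewrite addnS /=; apply: IH => s z /andP[s0 sn] z1.
have t0 := dyadic_angle_gt0 R (n + m).+1; have tS := dyadic_angleS R (n + m).
have h1 := h s z; have h2 := h (s + theta (n + m).+1) z.
have -> : g z = 2^-1%:C *: (g z + g z).
  rewrite -mulr2n -(scaler_nat 2 (g z)) scalerA.
  by rewrite -(rmorph_nat (real_complex R) 2) -rmorphM/= mulVf ?scale1r.
rewrite -scalerBr nrmZr ger0_norm// opprD addrACA.
have {}h1 : nrm (f (expi s * z) - g z) <= C.
  by apply: h1 => //; rewrite addnS s0/=; lra.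
have {}h2 : nrm (f (zeta (n + m).+1 * (expi s * z)) - g z) <= C.
  rewrite mulrA -expiD (addrC (theta _)); apply: h2 => //.
  by rewrite addnS; apply/andP; split; lra.
have := nrmD (f (expi s * z) - g z) (f (zeta (n + m).+1 * (expi s * z)) - g z).
lra.
Qed.

Definition rot_ucont f : Prop := forall e : R, 0 < e -> exists2 d : R, 0 < d &
  forall w, `|w| = 1 -> cabs (w - 1) < d ->
  forall z, `|z| = 1 -> nrm (f (w * z) - f z) <= e.

Lemma rot_ucont_expi f (e : R) : rot_ucont f -> 0 < e ->
  exists N, forall s, 0 <= s <= theta N ->
    forall z, `|z| = 1 -> nrm (f (expi s * z) - f z) <= e.
Proof.
move=> uf /uf[d d0 hd]; have d3 : 0 < d / 3 by lra.
have [N hN] := dyadic_angle_small d3; exists N => s /andP[s0 sN] z z1.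
apply: hd => //; first exact: norm_expi.
have := cabs_expi_dist s 0; rewrite expi0 subr0 ger0_norm//; lra.
Qed.

Definition circle_mean f : V := lim ((fun n => dyadic_avg n f) @ \oo).

Lemma cvg_circle_mean f : rot_ucont f ->
  (fun n => dyadic_avg n f) @ \oo --> circle_mean f.
Proof.
move=> uf; have [l fl] : exists l : V, (fun n => dyadic_avg n f) @ \oo --> l.
  apply: cauchy_nrm => e e0; have e2 : 0 < e / 2 by lra.
  have [N hN] := rot_ucont_expi uf e2; exists N => n Nn.
  suff : nrm (dyadic_avg n f - dyadic_avg N f) <= e / 2 by lra.
  rewrite -(subnKC Nn); apply: dyadic_avg_refine => s z /andP[s0 sN] z1.
  apply: hN => //; rewrite s0/=.
  have := dyadic_angle_gt0 R (N + (n - N)); lra.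
by rewrite /circle_mean (cvg_lim _ fl).
Qed.

Lemma dyadic_avg_rot f (w : R[i]) (e : R) : rot_ucont f -> `|w| = 1 -> 0 < e ->
  exists N, forall n, (N <= n)%N ->
    nrm (dyadic_avg n (fun z => f (w * z)) - dyadic_avg n f) <= e.
Proof.
move=> uf /expi_surj[t t0 ->] /(rot_ucont_expi uf)[N hN]; exists N => n Nn.
(* Write t = j theta_n + s with 0 <= s < theta_n. Rotation by j theta_n permutes the 2^n-th roots of
   unity and leaves the mean unchanged; uniform continuity handles s. *)
pose j := Num.truncn (t / theta n); pose s := t - theta n *+ j.
have th0 := dyadic_angle_gt0 R n.
have /andP[j1 j2] : j%:R <= t / theta n < j.+1%:R.
  by apply: truncn_itv; rewrite divr_ge0// ltW.
rewrite ler_pdivlMr// mulr_natl in j1; rewrite ltr_pdivrMr// mulr_natl mulrS in j2.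
have -> : dyadic_avg n (fun z => f (expi t * z)) =
          dyadic_avg n (fun z => f (expi s * z)).
  rewrite -[RHS](dyadic_avg_zetaX n j); congr dyadic_avg; apply/funext => z.
  by rewrite -expi_mulrn mulrA -expiD /s subrK.
apply: nrm_dyadic_avgB => z z1; apply: hN => //; rewrite /s.
by have tN := dyadic_angle_le R Nn; apply/andP; split; lra.
Qed.

End CircleMean.

(** * Fourier coefficients of the action *)

Section SpectralProjection.
Variables (R : realType) (A : cstarAlgType R[i]) (gamma : circle_action A).
Implicit Types (a b : A) (k : int) (z w : R[i]).

Lemma unit_circle_neq0 z : `|z| = 1 -> z != 0.
Proof. by move=> z1; rewrite -normr_gt0 z1. Qed.

Lemma unit_circle_exprz z k : `|z| = 1 -> `|z ^ k| = 1.
Proof.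
by move=> z1; case: k => n; rewrite ?NegzE -?exprnN ?normfV normrX z1 expr1n ?invr1.
Qed.

Lemma cabs_exprz_sub1 w k : `|w| = 1 ->
  cabs (w ^ k - 1) <= `|k|%N%:R * cabs (w - 1).
Proof.
move=> w1; have nat n : cabs (w ^+ n - 1) <= n%:R * cabs (w - 1).
  elim: n => [|n IH]; first by rewrite expr0 subrr mul0r (cabsr 0) normr0.
  have -> : w ^+ n.+1 - 1 = w * (w ^+ n - 1) + (w - 1).
    by rewrite mulrBr mulr1 -exprS addrA subrK.
  apply: le_trans (cabsD _ _) _.
  by rewrite cabsM (cabs_unit w1) mul1r -natr1 mulrDl mul1r lerD2r.
case: k => [n|n]; first exact: nat.
rewrite NegzE -exprnN abszN absz_nat.
have w0 := expf_neq0 n.+1 (unit_circle_neq0 w1).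
have -> : w ^- n.+1 - 1 = w ^- n.+1 * (- 1) * (w ^+ n.+1 - 1).
  by rewrite mulrN1 mulNr mulrBr mulVf// mulr1 opprB.
rewrite !cabsM cabs_unit; last by rewrite normfV normrX w1 expr1n invr1.
by rewrite (cabs_unit (normrN1 _)) !mul1r.
Qed.

Lemma circle_act_contractive z a : `|z| = 1 -> nrm (gamma z a) <= nrm a.
Proof.
move=> z1; apply: starhom_contractive.
- exact: circle_act_linear.
- exact: circle_actM.
- exact: circle_act_star.
- exact: circle_act_one.
Qed.

Lemma circle_act_near1 a (e : R) : 0 < e -> exists2 d : R, 0 < d &
  forall w, `|w| = 1 -> cabs (w - 1) < d -> nrm (gamma w a - a) < e.
Proof.
move=> e0; have := @circle_act_continuous _ _ gamma a.
move=> /subspace_continuousP/(_ 1 (normr1 _)) /cvgrPdist_lt/(_ e%:C).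
rewrite ltcR => /(_ e0) ; rewrite /from_subspace circle_act1 => /nbhs_ballP[d /ltcR0[r r0 ->]] hd.
exists r => // w w1 wr; rewrite nrm_distC -ltcR -nrmE; apply: hd => //.
by rewrite -ball_normE/= -normrN opprB cabsE ltcR.
Qed.

(** The integrand of the k-th Fourier coefficient of the orbit of a; its mean [spectral_proj k a] is
    the component of a in A^k. *)
Definition twist k a : R[i] -> A := fun z => z ^ (- k) *: gamma z a.

Lemma nrm_twist k a z : `|z| = 1 -> nrm (twist k a z) <= nrm a.
Proof.
move=> z1; rewrite nrmZ1; first exact: circle_act_contractive.
exact: unit_circle_exprz.
Qed.

Lemma twist_linear k z : `|z| = 1 -> linear (twist k ^~ z).
Proof.
move=> z1 c a b; rewrite /twist circle_act_linear// scalerDr !scalerA.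
by rewrite (mulrC c).
Qed.

Lemma twist_mul k a z w : `|z| = 1 -> `|w| = 1 ->
  twist k a (z * w) = twist k (twist k a w) z.
Proof.
move=> z1 w1; rewrite /twist circle_act_mul// circle_actZ// scalerA.
by rewrite exprzMl ?unitfE ?unit_circle_neq0.
Qed.

(** Strong continuity controls one element at a time. Since [twist k a (w * z)] differs from
    [twist k a z] by [twist k (twist k a w - a) z] and the action is contractive, continuity at w =
    1 is uniform in z. *)
Lemma rot_ucont_twist k a : rot_ucont (twist k a).
Proof.
move=> e e0; have e2 : 0 < e / 2 by lra.
have [d d0 hd] := circle_act_near1 a e2.
pose C : R := `|k|%N%:R * nrm a + 1.
have ka0 : 0 <= `|k|%N%:R * nrm a by rewrite mulr_ge0 ?nrm_ge0.
have C0 : 0 < C by rewrite /C; lra.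
exists (Num.min d (e / 2 / C)); first by rewrite lt_min d0 divr_gt0.
move=> w w1; rewrite lt_min => /andP[wd]; rewrite ltr_pdivlMr// => we z z1.
have -> : twist k a (w * z) - twist k a z = twist k (twist k a w - a) z.
  rewrite mulrC twist_mul//; have := twist_linear k z1 (-1) a (twist k a w).
  by rewrite !scaleN1r addrC => <-; rewrite addrC.
apply: le_trans (nrm_twist _ _ z1) _.
have -> : twist k a w - a =
    w ^ (- k) *: (gamma w a - a) + (w ^ (- k) - 1) *: a.
  by rewrite scalerBr scalerBl scale1r addrA subrK.
apply: le_trans (nrmD _ _) _; rewrite nrmZ1 ?unit_circle_exprz// nrmZ.
have := hd w w1 wd; have := cabs_exprz_sub1 (- k) w1; rewrite abszN.
rewrite -/(cabs _); have := nrm_ge0 a; have := cabs_ge0 (w - 1).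
move: we; rewrite /C; set x := cabs (w - 1); set y := cabs _.
move=> h1 x0 a0 h2 h3; have := ler_wpM2r a0 h2; rewrite /= => h4; nra.
Qed.

Definition spectral_proj k a : A := circle_mean (twist k a).

Lemma cvg_spectral_proj k a :
  (fun n => dyadic_avg n (twist k a)) @ \oo --> spectral_proj k a.
Proof. exact: cvg_circle_mean (rot_ucont_twist k a). Qed.

Lemma spectral_projP k a (e : R) : 0 < e -> exists N, forall n, (N <= n)%N ->
  nrm (dyadic_avg n (twist k a) - spectral_proj k a) < e.
Proof. by move: e; apply/cvg_nrmP; exact: cvg_spectral_proj. Qed.

Lemma spectral_proj_contractive k a : nrm (spectral_proj k a) <= nrm a.
Proof.
have := @closed_nrm_le R A (nrm a); move/closed_cvg_nrm; apply; last first.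
  exact: cvg_spectral_proj.
by move=> n /=; apply: nrm_dyadic_avg_cst => z; exact: nrm_twist.
Qed.

Lemma spectral_proj_linear k : linear (spectral_proj k).
Proof.
move=> c a b; have := @cvg_spectral_proj k (c *: a + b); move/cvg_nrm_uniq; apply.
have -> : (fun n => dyadic_avg n (twist k (c *: a + b))) =
   (fun n => c *: dyadic_avg n (twist k a) + dyadic_avg n (twist k b)).
  apply/funext => n; rewrite -dyadic_avg_linear; apply: eq_dyadic_avg => z z1.
  exact: twist_linear.
by apply: cvgD; [apply: cvgZr|]; exact: cvg_spectral_proj.
Qed.

(** gamma_w turns [twist k a z] into w^k times [twist k a (w * z)], and the rotation by w disappears
    in the limit. The constant 3 counts two comparisons with the limit and one of the mean with its
    rotation. *)
Lemma spectral_spectral_proj k a : spectral gamma k (spectral_proj k a).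
Proof.
move=> w w1; apply/eqP; rewrite -subr_eq0; apply/eqP.
apply: (@nrm_le_eps _ _ _ 3) => // e e0.
have [N hN] := spectral_projP k a e0.
have [M hM] := dyadic_avg_rot (rot_ucont_twist k a) w1 e0.
pose n := maxn N M; have {}hN := hN n (leq_maxl _ _); have {}hM := hM n (leq_maxr _ _).
set p := spectral_proj k a in hN *; set x := dyadic_avg n _ in hN hM.
have wx : gamma w x = w ^ k *: dyadic_avg n (fun z => twist k a (w * z)).
  rewrite (dyadic_avg_morph _ _ (circle_act_linear gamma w1)) -dyadic_avgZ.
  apply: eq_dyadic_avg => z z1 /=; rewrite /twist circle_actZ// circle_act_mul//.
  have w0 := unit_circle_neq0 w1.
  by rewrite exprzMl ?unitfE ?(unit_circle_neq0 z1)// scalerA mulrA -expfzDr//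
    subrr mul1r.
have h1 : nrm (gamma w p - gamma w x) <= e.
  have := circle_act_linear gamma w1 (-1) x p.
  rewrite !scaleN1r (addrC (- x)) (addrC (- gamma w x)) => <-.
  by apply: le_trans (circle_act_contractive _ w1) _; rewrite nrm_distC ltW.
have h2 : nrm (gamma w x - w ^ k *: x) <= e.
  by rewrite wx -scalerBr nrmZ1// unit_circle_exprz.
have h3 : nrm (w ^ k *: x - w ^ k *: p) <= e.
  by rewrite -scalerBr nrmZ1 ?unit_circle_exprz// ltW.
have := nrm_triangle (gamma w x) (gamma w p) (w ^ k *: p).
have := nrm_triangle (w ^ k *: x) (gamma w x) (w ^ k *: p); lra.
Qed.

End SpectralProjection.

(** * Density of the spectral subspaces *)

Section SpectralSubspaces.
Variables (R : realType) (A : cstarAlgType R[i]) (gamma : circle_action A).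
Implicit Types (a b : A) (k : int) (z w : R[i]) (n : nat).
Local Notation spectral := (spectral gamma).
Local Notation proj := (spectral_proj gamma).

Lemma circle_act0 z : `|z| = 1 -> gamma z 0 = 0.
Proof. by move=> z1; rewrite -(scale0r (0 : A)) circle_actZ// !scale0r. Qed.

Lemma circle_actD z a b : `|z| = 1 -> gamma z (a + b) = gamma z a + gamma z b.
Proof. by move=> z1; have := circle_act_linear gamma z1 1 a b; rewrite !scale1r. Qed.

Lemma spectral_zero k : spectral k 0.
Proof. by move=> z z1; rewrite circle_act0// scaler0. Qed.

Lemma spectralD k a b : spectral k a -> spectral k b -> spectral k (a + b).
Proof. by move=> ka kb z z1; rewrite circle_actD// ka// kb// scalerDr. Qed.

Lemma spectralZ k c a : spectral k a -> spectral k (c *: a).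
Proof. by move=> ka z z1; rewrite circle_actZ// ka// !scalerA mulrC. Qed.

Lemma spectralB k a b : spectral k a -> spectral k b -> spectral k (a - b).
Proof. by move=> ka kb; rewrite -scaleN1r; apply/spectralD/spectralZ. Qed.

Lemma spectral_one : spectral 0 1.
Proof. by move=> z z1; rewrite circle_act_one// expr0z scale1r. Qed.

Lemma closed_spectral k : closed (spectral k).
Proof.
have -> : spectral k =
    \bigcap_(z in [set z : R[i] | `|z| = 1]) [set a | gamma z a = z ^ k *: a].
  by apply/seteqP; split=> a h z; exact: h.
apply: closed_bigI => z /= z1; apply: closed_lip_eq.
  apply: (@lip_linear _ _ _ _ 1) => // [|a]; first exact: circle_act_linear.
  by rewrite mul1r circle_act_contractive.
exact/lipZ/lip_id.
Qed.

Lemma expi_exprz_neq1 (t : R) (m : int) : m != 0 -> 0 < t -> t *+ `|m|%N < pi ->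
  expi t ^ m != 1.
Proof.
move=> m0 t0 tm; have key (j : nat) : (0 < j)%N -> t *+ j < pi -> expi t ^+ j != 1.
  move=> j0 tj; rewrite -expi_mulrn eq_complex /= negb_and; apply/orP; right.
  by rewrite gt_eqF// sin_gt0_pi// tj andbT pmulrn_lgt0.
case: m m0 tm => [j|j] m0 tm; first by apply: key => //; rewrite lt0n.
by rewrite NegzE -exprnN invr_eq1; exact: key.
Qed.

(** The substitution z |-> zeta_n z leaves the mean unchanged and also multiplies it by zeta_n^m,
    which differs from 1 once |m| theta_n < pi. *)
Lemma dyadic_avg_exprz (V : lmodType R[i]) (v : V) (m : int) : m != 0 ->
  exists N, forall n, (N <= n)%N ->
    dyadic_avg n (fun z : R[i] => z ^ m *: v) = 0.
Proof.
move=> m0; have m1 : 0 < `|m|%N%:R :> R by rewrite ltr0n absz_gt0.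
have p0 : 0 < pi / (`|m|%N%:R + 1) :> R.
  by rewrite divr_gt0 ?pi_gt0// addr_gt0.
have [N hN] := dyadic_angle_small p0; exists N => n Nn.
set t := dyadic_angle R n.
have t0 : 0 < t by exact: dyadic_angle_gt0.
have tm : t *+ `|m|%N < pi.
  have := le_trans (dyadic_angle_le R Nn) hN.
  rewrite -/t ler_pdivlMr ?addr_gt0// -mulr_natr mulrDr mulr1; lra.
have := dyadic_avg_zeta n (fun z : R[i] => z ^ m *: v); rewrite -/t.
have -> : dyadic_avg n (fun z : R[i] => (expi t * z) ^ m *: v) =
    expi t ^ m *: dyadic_avg n (fun z : R[i] => z ^ m *: v).
  rewrite -dyadic_avgZ; apply: eq_dyadic_avg => z z1.
  by rewrite exprzMl ?unitfE ?unit_circle_neq0 ?norm_expi// scalerA.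
move=> /eqP; rewrite -subr_eq0 -[X in _ - X]scale1r -scalerBl scaler_eq0.
by rewrite subr_eq0 (negPf (expi_exprz_neq1 m0 t0 tm)) => /eqP.
Qed.

Lemma spectral_proj_id k b : spectral k b -> proj k b = b.
Proof.
move=> kb; have := @cvg_spectral_proj _ _ gamma k b; move/cvg_nrm_uniq; apply.
have -> : (fun n => dyadic_avg n (twist gamma k b)) = (fun=> b).
  apply/funext => n; rewrite -[RHS](dyadic_avg_cst n b); apply: eq_dyadic_avg => z z1.
  rewrite /twist kb// scalerA -expfzDr ?unit_circle_neq0// addNr.
  by rewrite expr0z scale1r.
exact: cvg_cst.
Qed.

Lemma spectral_proj_eq0 j k b : j != k -> spectral j b -> proj k b = 0.
Proof.
move=> jk jb; apply: (@nrm_le_eps _ _ _ 1) => // e e0.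
have [N hN] := spectral_projP gamma k b e0.
have [|M hM] := @dyadic_avg_exprz A b (j - k); first by rewrite subr_eq0.
have := hN (maxn N M) (leq_maxl _ _).
rewrite (_ : dyadic_avg _ _ = 0) ?sub0r ?nrmN ?mul1r; first exact: ltW.
rewrite -[RHS](hM (maxn N M) (leq_maxr _ _)); apply: eq_dyadic_avg => z z1.
by rewrite /twist jb// scalerA -expfzDr ?unit_circle_neq0// addrC.
Qed.

(* |z - 1|^2 = 2 (1 - Re z) on the circle, so the bound 2 |a| away from 1 is
   absorbed by the second term. *)
Lemma circle_act_cos_bound a (e : R) : 0 < e -> exists2 C : R, 0 <= C &
  forall z, `|z| = 1 -> nrm (gamma z a - a) <= e + C * (1 - complex.Re z).
Proof.
move=> e0; have [d d0 hd] := circle_act_near1 gamma a e0; have a0 := nrm_ge0 a.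
have c0 : 0 <= 4 * nrm a / d ^+ 2.
  by apply: divr_ge0; [exact: mulr_ge0|exact: sqr_ge0].
exists (4 * nrm a / d ^+ 2) => // z z1.
have zz : complex.Re z ^+ 2 + complex.Im z ^+ 2 = 1.
  by apply: (@complexI R); rewrite add_Re2_Im2 z1 expr1n.
have re1 : complex.Re z <= 1 by have := sqr_ge0 (complex.Im z); nra.
have [zd|zd] := ltP (cabs (z - 1)) d.
  by apply: le_trans (ltW (hd _ z1 zd)) _; rewrite lerDl mulr_ge0// subr_ge0.
have : d ^+ 2 <= cabs (z - 1) ^+ 2 by rewrite ler_pXn2r// ?nnegrE ?cabs_ge0// ltW.
have -> : cabs (z - 1) ^+ 2 = 2 * (1 - complex.Re z).
  apply: (@complexI R); rewrite rmorphXn/= -cabsE -add_Re2_Im2.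
  by case: z z1 zz {re1 zd} => x y _ /= zz; congr (_%:C); rewrite subr0; nra.
move=> dz; have : nrm (gamma z a - a) <= 2 * nrm a.
  by have := nrmB (gamma z a) a; have := circle_act_contractive gamma a z1; lra.
move/le_trans; apply; have d2 : 0 < d ^+ 2 by rewrite exprn_gt0.
have -> : 2 * nrm a = 4 * nrm a / d ^+ 2 * (d ^+ 2 / 2).
  by have dn0 := lt0r_neq0 d0; field.
have : d ^+ 2 / 2 <= 1 - complex.Re z by lra.
move/(ler_wpM2l c0)/le_trans; apply; lra.
Qed.

(* Kernel of de la Vallee-Poussin type: a positive trigonometric polynomial of
   degree N that concentrates at z = 1 as N grows. *)
Definition cos_kernel (N : nat) z : R := (1 + complex.Re z) ^+ N.

Definition cos_kernel_coef (N i : nat) : R := 2 ^- N * 'C(N.*2, i)%:R.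

(** On the circle 1 + Re z = (1 + z)^2 / (2 z), so the N-th power is a binomial expansion of degree
    2N. Index i stands for the exponent i - N; the constant term sits at i = N. *)
Lemma cos_kernelE N z : `|z| = 1 -> (cos_kernel N z)%:C =
  \sum_(i < N.*2.+1) (cos_kernel_coef N i)%:C * z ^ (i%:Z - N%:Z).
Proof.
move=> z1; have z0 := unit_circle_neq0 z1.
have zz : z * z^*%C = 1 by rewrite -sqr_normc z1 expr1n.
have zV : z^-1 = z^*%C by apply: (mulfI z0); rewrite divff.
have two : (2 : R[i]) != 0 by rewrite pnatr_eq0.
have twoE : (2 : R)%:C = 2 by rewrite rmorph_nat.
have h : (1 + complex.Re z)%:C = 2^-1 * z^-1 * (1 + z) ^+ 2.
  have := addcJ z; rewrite -zV rmorphD rmorph1 /= => h.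
  have -> : (complex.Re z)%:C = 2^-1 * (z + z^-1) by rewrite h mulKf.
  by field; rewrite z0.
rewrite rmorphXn/= h exprMn -exprM mul2n exprDn mulr_sumr.
apply: eq_bigr => i _; rewrite expr1n mul1r -[_ *+ 'C(_, _)]mulr_natr expfzDr// -exprnP -exprnN.
rewrite rmorphM/= fmorphV/= rmorphXn/= twoE rmorph_nat exprMn !exprVn; ring.
Qed.

Lemma dyadic_avg_cos_kernel N : exists n0, forall n, (n0 <= n)%N ->
  dyadic_avg n (fun z => (cos_kernel N z)%:C : R[i]^o) = (cos_kernel_coef N N)%:C.
Proof.
have [n0 hn0] : exists n0, forall (i : 'I_(N.*2.+1)), i != N :> nat ->
    forall n, (n0 <= n)%N ->
    dyadic_avg n (fun z => z ^ (i%:Z - N%:Z) *: (1 : R[i]^o)) = 0.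
  have h (i : 'I_(N.*2.+1)) : exists n0, i != N :> nat ->
    forall n, (n0 <= n)%N ->
    dyadic_avg n (fun z => z ^ (i%:Z - N%:Z) *: (1 : R[i]^o)) = 0.
    have [->|iN] := eqVneq (i : nat) N; first by exists 0%N.
    have [|n0 h0] := @dyadic_avg_exprz R[i]^o 1 (i%:Z - N%:Z).
      by rewrite subr_eq0.
    by exists n0.
  have [f hf] := choice h; exists (\max_(i < N.*2.+1) f i)%N => i iN n nn.
  by apply: hf => //; apply: leq_trans nn; exact: leq_bigmax.
exists n0 => n nn.
have -> : dyadic_avg n (fun z => (cos_kernel N z)%:C : R[i]^o) =
    \sum_(i < N.*2.+1) (cos_kernel_coef N i)%:C *:
      dyadic_avg n (fun z => z ^ (i%:Z - N%:Z) *: (1 : R[i]^o)).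
  transitivity (dyadic_avg n (fun z => \sum_(i < N.*2.+1)
      (cos_kernel_coef N i)%:C *: (z ^ (i%:Z - N%:Z) *: (1 : R[i]^o)))).
    apply: eq_dyadic_avg => z z1; rewrite cos_kernelE//; apply: eq_bigr => i _.
    by rewrite /GRing.scale/= mulr1.
  by rewrite dyadic_avg_sum; apply: eq_bigr => i _; rewrite dyadic_avgZ.
have NN : (N < N.*2.+1)%N by rewrite ltnS -addnn leq_addr.
rewrite (bigD1 (Ordinal NN))//= big1 => [|i iN]; last by rewrite hn0 ?scaler0.
rewrite addr0 subrr; under eq_fun do rewrite expr0z scale1r.
by rewrite dyadic_avg_cst /GRing.scale/= mulr1.
Qed.

Lemma cos_kernel_coef_gt0 N : 0 < cos_kernel_coef N N.
Proof.
by rewrite mulr_gt0 ?invr_gt0 ?exprn_gt0// ltr0n bin_gt0 -addnn leq_addr.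
Qed.

(** From N to N + 1 the mean of the kernel grows by (2N + 1) / (N + 1), which tends to 2, the value
    of 1 + Re z at z = 1. This measures the concentration at 1. *)
Lemma cos_kernel_coefS N :
  N.+1%:R * cos_kernel_coef N.+1 N.+1 = N.*2.+1%:R * cos_kernel_coef N N.
Proof.
have h : (N.+1 * 'C(N.+1.*2, N.+1) = 2 * (N.*2.+1 * 'C(N.*2, N)))%N.
  have e1 := mul_bin_diag N.+1.*2 N; have e2 := mul_bin_diag N.*2.+1 N.
  have e3 : 'C(N.*2.+1, N.+1) = 'C(N.*2.+1, N).
    by rewrite -[RHS]bin_sub; [congr 'C(_, _)|]; lia.
  rewrite doubleS /= in e1 e2 *.
  apply/eqP; rewrite -(eqn_pmul2l (ltn0Sn N)) -e1; apply/eqP.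
  have -> : N.*2.+2 = (2 * N.+1)%N by lia.
  rewrite -e3 in e1 *. nia.
rewrite /cos_kernel_coef mulrCA -natrM h [in RHS]mulrCA -natrM natrM exprS.
by have t : (2 : R) ^+ N != 0 by [rewrite expf_neq0]; field.
Qed.

(** The approximant is the mean of K_N(z) gamma_z(a) divided by the mean M of the kernel K_N. The
    error is at most the mean of K_N (e/4 + C (1 - Re z)) over M. As K_N (1 - Re z) = 2 K_N -
    K_(N+1) has mean 2M - M' = M / (N + 1), it suffices that C / (N + 1) be small. Distinct
    frequencies are needed for the cross terms in [extend_state]. *)
Lemma spectral_dense a (e : R) : 0 < e ->
  exists n (k : 'I_n -> int) (x : 'I_n -> A),
    [/\ injective k, forall i, spectral (k i) (x i) & nrm (a - \sum_i x i) < e].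
Proof.
move=> e0; have e4 : 0 < e / 4 by lra.
have [C C0 hC] := circle_act_cos_bound a e4.
pose N := Num.truncn (C / (e / 4)).
pose M := cos_kernel_coef N N; have M0 : 0 < M by exact: cos_kernel_coef_gt0.
pose M' := cos_kernel_coef N.+1 N.+1.
have MM' : C * (2 * M - M') <= e / 4 * M.
  have : C / (e / 4) < N.+1%:R by exact: truncnS_gt.
  rewrite ltr_pdivrMr// => hN.
  have := cos_kernel_coefS N; rewrite -/M -/M'.
  have -> : N.*2.+1%:R = 2 * N.+1%:R - 1 :> R.
    by rewrite -mul2n -!natr1 natrM; ring.
  have n0 : 0 < N.+1%:R :> R by rewrite ltr0n.
  set y : R := N.+1%:R in hN n0 * => h.
  rewrite -(ler_pM2l n0); have : y * (2 * M - M') = M by lra.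
  by move=> h2; rewrite mulrCA h2; nra.
pose c (i : 'I_(N.*2.+1)) := cos_kernel_coef N i.
(* The sign is opposite to the exponent i - N of the kernel since [twist k] carries z^(-k). *)
pose k (i : 'I_(N.*2.+1)) : int := N%:Z - i%:Z.
pose T := \sum_i (c i)%:C *: proj (k i) a.
pose Tn n := \sum_i (c i)%:C *: dyadic_avg n (twist gamma (k i) a).
have TnT : Tn @ \oo --> T.
  apply: cvg_big => [|i _]; first exact: add_continuous.
  by apply: cvgZr; exact: cvg_spectral_proj.
have [n1 hn1] := dyadic_avg_cos_kernel N.
have [n2 hn2] := dyadic_avg_cos_kernel N.+1.
have em : 0 < e / 4 * M by rewrite mulr_gt0.
have [n3 hn3] := (cvg_nrmP Tn T).1 TnT _ em.
pose n := maxn n1 (maxn n2 n3).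
have {}hn1 := hn1 n (leq_maxl _ _).
have {}hn2 : dyadic_avg n (fun z => (cos_kernel N.+1 z)%:C : R[i]^o) = M'%:C.
  by apply: hn2; rewrite /n leq_max leq_maxl orbT.
have {}hn3 : nrm (Tn n - T) < e / 4 * M.
  by apply: hn3; rewrite /n !leq_max leqnn !orbT.
have key : nrm (Tn n - M%:C *: a) <= e / 4 * M + e / 4 * M.
  have -> : Tn n - M%:C *: a =
      dyadic_avg n (fun z => (cos_kernel N z)%:C *: (gamma z a - a)).
    have -> : M%:C *: a = dyadic_avg n (fun z => (cos_kernel N z)%:C *: a).
      rewrite -hn1 (@dyadic_avg_morph R R[i]^o A n (fun c => (c : R[i]) *: a))//.
      by move=> x y w; rewrite scalerDl scalerA.
    rewrite /Tn; under eq_bigr do rewrite -dyadic_avgZ.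
    rewrite -dyadic_avg_sum -dyadic_avgB; apply: eq_dyadic_avg => z z1.
    rewrite scalerBr; congr (_ - _); rewrite cos_kernelE// scaler_suml.
    by apply: eq_bigr => i _; rewrite /twist scalerA opprB.
  (* The weight is K_N (e/4 + C (1 - Re z)), rewritten with (1 + Re z) K_N = K_(N+1). *)
  have := @nrm_dyadic_avg_le _ _ n (fun z => (cos_kernel N z)%:C *: (gamma z a - a))
    (fun z => (e / 4 + 2 * C) * cos_kernel N z - C * cos_kernel N.+1 z).
  have -> : dyadic_avg n (fun z : R[i] =>
      ((e / 4 + 2 * C) * cos_kernel N z - C * cos_kernel N.+1 z)%:C : R[i]^o) =
      ((e / 4 + 2 * C) * M - C * M')%:C.
    rewrite rmorphB/= (rmorphM _ C) (rmorphM _ (_ + _)) /= -hn1 -hn2.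
    rewrite -[_ * dyadic_avg _ _]dyadic_avgZ -[X in _ - X]dyadic_avgZ -dyadic_avgB.
    by apply: eq_dyadic_avg => z _; rewrite rmorphB/= !rmorphM.
  rewrite lecR => /(_ _)/le_trans; apply; last by lra.
  move=> z z1; rewrite nrmZr.
  have zz : complex.Re z ^+ 2 + complex.Im z ^+ 2 = 1.
    by apply: (@complexI R); rewrite add_Re2_Im2 z1 expr1n.
  have re1 : 0 <= 1 + complex.Re z by have := sqr_ge0 (complex.Im z); nra.
  have K0 : 0 <= cos_kernel N z by rewrite exprn_ge0.
  rewrite ger0_norm// [cos_kernel N.+1 z]exprS.
  have := ler_wpM2l K0 (hC z z1); rewrite -/(cos_kernel N z) /=; lra.
exists N.*2.+1, k, (fun i => (M^-1 * c i)%:C *: proj (k i) a); split.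
- by move=> i j; rewrite /k => /addrI/oppr_inj[] /val_inj.
- by move=> i; apply/spectralZ/spectral_spectral_proj.
have -> : \sum_(i < N.*2.+1) (M^-1 * c i)%:C *: proj (k i) a = M^-1%:C *: T.
  by rewrite scaler_sumr; apply: eq_bigr => i _; rewrite scalerA -rmorphM.
have -> : a - M^-1%:C *: T = M^-1%:C *: (M%:C *: a - T).
  by rewrite scalerBr scalerA -rmorphM/= mulVf ?gt_eqF// scale1r.
rewrite nrmZr ger0_norm ?invr_ge0 ?(ltW M0)// mulrC ltr_pdivrMr//.
have := nrm_triangle (Tn n) (M%:C *: a) T; rewrite (nrm_distC _ (Tn n)); nra.
Qed.

End SpectralSubspaces.

(** * The conditional expectation as a Riemann integral *)

Section RiemannIntegral.
Variables (R : realType) (V : normedModType R[i]).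
Implicit Types (f g F : R -> V) (v w : V) (a b : R).

(* A primitive with a quadratic error term: the Riemann sums telescope. *)
Definition is_primitive F f : Prop := exists2 L : R, 0 <= L &
  forall s xi t, s <= xi <= t ->
    nrm (F t - F s - (t - s)%:C *: f xi) <= L * (t - s) ^+ 2.

Lemma partition_sum (x : nat -> R) n :
  \sum_(i < n) (x i.+1 - x i) = x n - x 0%N.
Proof. by rewrite -(big_mkord xpredT (fun i => x i.+1 - x i)) telescope_sumr. Qed.

Lemma tagged_partition_le a b n x xi i : tagged_partition a b n x xi ->
  (i < n)%N -> 0 <= x i.+1 - x i.
Proof. by case=> _ _ h /h /andP[h1 h2]; rewrite subr_ge0 (le_trans h1). Qed.

Lemma riemann_sum_dist f g a b n x xi (C : R) : tagged_partition a b n x xi ->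
  (forall t, nrm (f t - g t) <= C) ->
  nrm (riemann_sum f n x xi - riemann_sum g n x xi) <= (b - a) * C.
Proof.
move=> tp fg; rewrite /riemann_sum -sumrB; apply: le_trans (nrm_sum _ _ _) _.
case: (tp) => <- <- _; rewrite -partition_sum mulr_suml; apply: ler_sum => i _.
have xi0 := tagged_partition_le tp (ltn_ord i).
by rewrite -scalerBr nrmZr ger0_norm// ler_wpM2l ?fg.
Qed.

Lemma primitive_riemann F f a b : a <= b -> is_primitive F f ->
  is_riemann_integral f a b (F b - F a).
Proof.
move=> ab [L L0 hF] e e0; have c0 : 0 < L * (b - a) + 1.
  by rewrite ltr_wpDl// mulr_ge0// subr_ge0.
exists (e / (L * (b - a) + 1)); first exact: divr_gt0.
move=> n x xi tp xd; rewrite nrmE ltcR nrm_distC.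
have -> : F b - F a = \sum_(i < n) (F (x i.+1) - F (x i)).
  rewrite -(big_mkord xpredT (fun i => F (x i.+1) - F (x i))).
  by rewrite (telescope_sumr (fun i => F (x i)))//; case: tp => -> ->.
rewrite /riemann_sum -sumrB; apply: le_lt_trans (nrm_sum _ _ _) _.
set d := e / _ in xd *.
have d0 : 0 < d by exact: divr_gt0.
apply: (@le_lt_trans _ _ (\sum_(i < n) L * d * (x i.+1 - x i))).
  apply: ler_sum => i _; case: (tp) => _ _ h.
  apply: le_trans (hF _ _ _ (h i (ltn_ord i))) _.
  have xi0 := tagged_partition_le tp (ltn_ord i).
  have := xd i (ltn_ord i); rewrite -mulrA => xid; rewrite ler_wpM2l// expr2.
  by rewrite ler_wpM2r// ltW.
rewrite -mulr_sumr partition_sum; case: tp => -> -> _.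
have -> : e = (L * (b - a) + 1) * d by rewrite mulrC divfK// gt_eqF.
by rewrite mulrAC ltr_pM2r// ltrDl.
Qed.

Lemma riemann_integral_unif f a b v : a <= b ->
  (forall e : R, 0 < e -> exists g w, [/\ is_riemann_integral g a b w,
     forall t, nrm (f t - g t) <= e & nrm (w - v) <= e]) ->
  is_riemann_integral f a b v.
Proof.
move=> ab h e e0; have c0 : 0 < b - a + 2 by lra.
(* Three errors add up to (b - a + 2) e' = e/2: the distance of the two Riemann sums, the error of
   the sum for g, and the distance of w from v. *)
pose e' := e / (b - a + 2) / 2; have e'0 : 0 < e' by rewrite !divr_gt0.
have [g [w [gw fg wv]]] := h e' e'0.
have [d d0 hd] := gw e' e'0; exists d => // n x xi tp xd; rewrite nrmE ltcR.
have h1 := riemann_sum_dist tp fg.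
have := hd n x xi tp xd; rewrite nrmE ltcR => h2.
have := nrm_triangle (riemann_sum g n x xi) (riemann_sum f n x xi) v.
have := nrm_triangle w (riemann_sum g n x xi) v.
have : (b - a + 2) * e' = e / 2 by rewrite /e'; field; rewrite gt_eqF.
nra.
Qed.

Lemma is_riemann_integral_uniq f a b v w : a < b ->
  is_riemann_integral f a b v -> is_riemann_integral f a b w -> v = w.
Proof.
move=> ab fv fw; apply/eqP; rewrite -subr_eq0; apply/eqP.
apply: (@nrm_le_eps _ _ _ 2) => // e e0.
have [d1 d10 h1] := fv e e0; have [d2 d20 h2] := fw e e0.
pose d := Num.min d1 d2; have d0 : 0 < d by rewrite lt_min d10.
pose n := (Num.truncn ((b - a) / d)).+1.
have n0 : 0 < n%:R :> R by rewrite ltr0n.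
have nd : (b - a) / n%:R < d.
  by rewrite ltr_pdivrMr// mulrC -ltr_pdivrMr// truncnS_gt.
pose x (i : nat) := a + (b - a) * (i%:R / n%:R).
have xS i : x i.+1 - x i = (b - a) / n%:R.
  by rewrite /x -natr1; field; rewrite gt_eqF.
have tp : tagged_partition a b n x x.
  split=> [||i _]; rewrite ?lexx/=; first by rewrite /x mul0r mulr0 addr0.
    by rewrite /x divff ?gt_eqF// mulr1 addrC subrK.
  by rewrite -subr_ge0 xS divr_ge0 ?subr_ge0 ?ltW.
have := h1 n x x tp; have := h2 n x x tp.
move=> /(_ _)/[swap] /(_ _) => k1 k2.
have {}k1 : nrm (riemann_sum f n x x - v) < e.
  rewrite -ltcR -nrmE; apply: k1 => i _; rewrite xS.
  by apply: lt_le_trans nd _; rewrite ge_min lexx.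
have {}k2 : nrm (riemann_sum f n x x - w) < e.
  rewrite -ltcR -nrmE; apply: k2 => i _; rewrite xS.
  by apply: lt_le_trans nd _; rewrite ge_min lexx orbT.
have := nrm_triangle (riemann_sum f n x x) v w; rewrite (nrm_distC v (riemann_sum _ _ _ _)); lra.
Qed.

Lemma riemann_integralE f a b v : a < b -> is_riemann_integral f a b v ->
  riemann_integral f a b = v.
Proof.
by move=> ab fv; apply: xget_unique => // w fw; exact: is_riemann_integral_uniq ab fw fv.
Qed.

Lemma is_primitive_sum n (F f : 'I_n -> R -> V) :
  (forall i, is_primitive (F i) (f i)) ->
  is_primitive (fun t => \sum_i F i t) (fun t => \sum_i f i t).
Proof.
move=> h; have hi i : exists L : R, 0 <= L /\
    forall s xi t, s <= xi <= t ->
    nrm (F i t - F i s - (t - s)%:C *: f i xi) <= L * (t - s) ^+ 2.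
  by have [L] := h i; exists L.
have [L hL] := choice hi.
exists (\sum_i L i) => [|s xi t st]; first by apply: sumr_ge0 => i _; case: (hL i).
rewrite scaler_sumr -!sumrB mulr_suml; apply: le_trans (nrm_sum _ _ _) _.
by apply: ler_sum => i _; apply: (hL i).2.
Qed.

End RiemannIntegral.

Section ExpiPrimitive.
Variable R : realType.

Lemma real_primitive (F f df : R -> R) (L : R) :
  (forall x : R, is_derive x (1 : R) F (f x)) ->
  (forall x : R, is_derive x (1 : R) f (df x)) -> (forall x, `|df x| <= L) ->
  forall s xi t, s <= xi <= t ->
  `|F t - F s - (t - s) * f xi| <= L * (t - s) ^+ 2.
Proof.
move=> hF hf hL s xi t /andP[sx xt]; have st := le_trans sx xt.
have cF : {within `[s, t], continuous F}.
  apply: continuous_subspaceT => x; apply/differentiable_continuous.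
  by rewrite -derivable1_diffP; case: (hF x).
have [c cst ->] := MVT_segment st (fun x _ => hF x) cF.
have L0 : 0 <= L by exact: le_trans (hL 0).
rewrite mulrC -mulrBr normrM ger0_norm ?subr_ge0// expr2 mulrCA ler_wpM2l ?subr_ge0//.
apply: le_trans (derive_lipschitz hf hL _ _) _; rewrite ler_wpM2l//.
move: cst; rewrite in_itv/= => /andP[h1 h2]; rewrite ler_norml; apply/andP; split; lra.
Qed.

Lemma is_primitive_expi (V : normedModType R[i]) (k : int) (v : V) : k != 0 ->
  exists2 F : R -> V, is_primitive F (fun t => expi t ^ k *: v) & F (2 * pi) = F 0.
Proof.
move=> k0; pose c : R := k%:~R; have c0 : c != 0 by rewrite intr_eq0.
(* [Fr] and [Fi] are the real and imaginary parts of exp(i k t) / (i k), so that the real mean value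
   theorem applies to each. *)
pose Fr t : R := c^-1 * sin (c * t); pose Fi t : R := - c^-1 * cos (c * t).
have dlin (x : R) : is_derive x (1 : R) ( *%R c) c.
  by have := is_deriveZ c (is_derive_id x (1 : R)); rewrite /GRing.scale/= mulr1.
have dsin (x : R) : is_derive x (1 : R) (fun t => sin (c * t)) (cos (c * x) * c).
  exact: is_derive1_comp.
have dcos (x : R) : is_derive x (1 : R) (fun t => cos (c * t)) (- sin (c * x) * c).
  exact: is_derive1_comp.
have dFr (x : R) : is_derive x (1 : R) Fr (cos (c * x)).
  have := is_deriveZ c^-1 (dsin x); rewrite /GRing.scale/=.
  by rewrite mulrCA mulVf// mulr1.
have dFi (x : R) : is_derive x (1 : R) Fi (sin (c * x)).
  have := is_deriveZ (- c^-1) (dcos x); rewrite /GRing.scale/=.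
  by have -> : - c^-1 * (- sin (c * x) * c) = sin (c * x) by field.
exists (fun t => (Fr t +i* Fi t) *: v); last first.
  have -> : Fr (2 * pi) +i* Fi (2 * pi) = Fr 0 +i* Fi 0; last by [].
  have : expi (c * (2 * pi)) = expi (c * 0).
    by rewrite mulr0 expi0 /c mulrzl expi_mulrz expi_2pi exp1rz.
  by rewrite /Fr /Fi => -[-> ->].
exists (2 * `|c| * nrm v) => [|s xi t st].
  by rewrite !mulr_ge0// nrm_ge0.
rewrite -scalerBl scalerA -scalerBl nrmZ mulrAC ler_wpM2r ?nrm_ge0//.
apply: le_trans (cabs_le _) _.
have cxi : expi xi ^ k = cos (c * xi) +i* sin (c * xi).
  by rewrite -expi_mulrz /c mulrzl.
rewrite cxi /= !mul0r subr0 addr0 -mulrA mulr_natl mulr2n lerD//.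
- apply: (real_primitive dFr dcos) st => x.
  by rewrite mulNr normrN normrM ler_piMl// sin_max.
- apply: (real_primitive dFi dsin) st => x.
  by rewrite normrM ler_piMl// cos_max.
Qed.

Lemma is_primitive_cst (V : normedModType R[i]) (v : V) :
  is_primitive (fun t : R => t%:C *: v) (fun=> v).
Proof.
by exists 0 => // s xi t _; rewrite -scalerBl -rmorphB/= subrr nrm0 mul0r.
Qed.

End ExpiPrimitive.

Section Expectation.
Variables (R : realType) (A : cstarAlgType R[i]) (gamma : circle_action A).
Implicit Types (a b : A).
Local Notation spectral := (spectral gamma).
Local Notation proj := (spectral_proj gamma).

Lemma spectral_proj_sum k n (x : 'I_n -> A) :
  proj k (\sum_i x i) = \sum_i proj k (x i).
Proof.
have lin := spectral_proj_linear gamma k.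
have p0 : proj k 0 = 0.
  by have := lin (-1) 0 0; rewrite scaler0 add0r scaleN1r addNr.
by apply: (big_morph _ _ p0) => u v; have := lin 1 u v; rewrite !scale1r.
Qed.

Lemma spectral_projB k a b : proj k (a - b) = proj k a - proj k b.
Proof.
have := spectral_proj_linear gamma k (-1) b a.
by rewrite !scaleN1r (addrC (- b)) (addrC (- proj k b)).
Qed.

(** On sums of spectral elements, primitives evaluate the integral: a nonzero frequency has a
    periodic primitive and contributes 0, frequency 0 contributes 2 pi times its term. Density and
    contractivity of the action give the rest. *)
Lemma circle_riemann a :
  is_riemann_integral (fun t => gamma (expi t) a) 0 (2 * pi)
    ((2 * pi)%:C *: proj 0 a).
Proof.
have pi2 : 0 <= 2 * pi :> R by rewrite mulr_ge0// pi_ge0.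
apply: riemann_integral_unif => // e e0.
have c0 : 0 < 2 * pi + 1 :> R by lra.
(* This gives both e' <= e, for the integrands, and 2 pi e' <= e, for the integrals. *)
pose e' := e / (2 * pi + 1); have e'0 : 0 < e' by exact: divr_gt0.
have e'e : e' * (2 * pi + 1) = e by rewrite divfK// gt_eqF.
have [n [k [x [kinj xk ax]]]] := spectral_dense gamma a e'0.
pose b := \sum_i x i.
exists (fun t => gamma (expi t) b), ((2 * pi)%:C *: proj 0 b); split=> [|t|].
- have hF i : exists F : R -> A, is_primitive F (fun t => expi t ^ k i *: x i) /\
      F (2 * pi) - F 0 = (2 * pi)%:C *: proj 0 (x i).
    have [ki0|ki0] := eqVneq (k i) 0.
      exists (fun t => t%:C *: x i); rewrite ki0; split.
        have [L L0 hL] := is_primitive_cst (x i).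
        by exists L => // s xi t; rewrite expr0z scale1r; exact: hL.
      rewrite scale0r subr0 (spectral_proj_id (k := 0))// -ki0; exact: xk.
    have [F hF F0] := is_primitive_expi (x i) ki0; exists F; split=> //.
    by rewrite F0 subrr (spectral_proj_eq0 ki0 (xk i)) scaler0.
  have [F {}hF] := choice hF.
  have := primitive_riemann pi2 (is_primitive_sum (fun i => (hF i).1)).
  rewrite -sumrB; under eq_bigr do rewrite (hF _).2.
  rewrite -scaler_sumr -spectral_proj_sum; congr is_riemann_integral.
  apply/funext => t; rewrite -[RHS]scale1r.
  have h1 := norm_expi t.
  rewrite scale1r (big_morph (gamma (expi t)) (fun u v => circle_actD gamma u v h1)
    (circle_act0 gamma h1)).
  by apply: eq_bigr => i _; rewrite xk.
- have := circle_act_linear gamma (norm_expi t) (-1) b a.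
  rewrite !scaleN1r (addrC (- b)) (addrC (- gamma _ b)) => <-.
  apply: le_trans (circle_act_contractive _ _ (norm_expi t)) _; nra.
- rewrite -scalerBr -spectral_projB nrmZr ger0_norm//.
  have := spectral_proj_contractive gamma 0 (b - a); rewrite (nrm_distC b).
  have := nrm_ge0 (a - b); rewrite -/b in ax; nra.
Qed.

Lemma circle_averageE a : circle_average gamma a = proj 0 a.
Proof.
have pi2 : 0 < 2 * pi :> R by rewrite mulr_gt0// pi_gt0.
rewrite /circle_average (riemann_integralE pi2 (circle_riemann a)).
by rewrite scalerA -rmorphM/= mulVf ?gt_eqF// scale1r.
Qed.

Lemma val_expectation a : val (expectation gamma a) = proj 0 a.
Proof.
rewrite /expectation insubdK circle_averageE//.
by apply/fixed_predP; exact: spectral_spectral_proj.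
Qed.

End Expectation.

(** * Entire extensions *)

Section EntireUniqueness.
Variables (R : realType) (V : normedModType R[i]).
Implicit Types (c d : nat -> V).

Lemma geometric_tail (t : R) p q : 0 <= t -> t <= 2^-1 ->
  \sum_(p <= m < p + q) t ^+ m <= 2 * t ^+ p - 2 * t ^+ (p + q).
Proof.
move=> t0 t2; elim: q => [|q IH]; first by rewrite addn0 big_geq// subrr.
rewrite addnS big_nat_recr ?leq_addr//=; have := exprn_ge0 (p + q) t0.
by rewrite exprS; nra.
Qed.

Lemma series_terms_bounded c (l : V) : series c @ \oo --> l ->
  exists2 M : R, 0 <= M & forall n, nrm (c n) <= M.
Proof.
move=> /cvg_nrmP/(_ 1 ltr01)[N hN].
have S0 : 0 <= \sum_(i < N) nrm (c i) by apply: sumr_ge0 => i _; exact: nrm_ge0.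
exists (\sum_(i < N) nrm (c i) + 2) => [|n]; first by lra.
have [nN|Nn] := ltnP n N.
  rewrite (bigD1 (Ordinal nN))//= -addrA lerDl.
  by rewrite addr_ge0//; apply: sumr_ge0 => i _; exact: nrm_ge0.
have -> : c n = series c n.+1 - series c n.
  by rewrite /series/= big_nat_recr//= addrAC subrr add0r.
have := nrm_triangle l (series c n.+1) (series c n).
have := hN n Nn; have := hN n.+1 (leqW Nn).
rewrite (nrm_distC l (series c n)); lra.
Qed.

(** Convergence at t = 1 bounds all coefficients by some M. If those before n vanish, then for 0 < t
    <= 1/2 a partial sum bounds |d_n| t^n by t^(n+1) plus a geometric tail of at most 2 M t^(n+1);
    divide by t^n. *)
Lemma power_series_eq0 d :
  (forall t : R, series (fun n => t%:C ^+ n *: d n) @ \oo --> (0 : V)) ->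
  forall n, d n = 0.
Proof.
move=> hd; have [M M0 dM] : exists2 M : R, 0 <= M & forall n, nrm (d n) <= M.
  apply: (@series_terms_bounded d 0); have := hd 1.
  by under eq_fun do rewrite rmorph1 expr1n scale1r.
elim/ltn_ind => n IH; apply: (@nrm_le_eps _ _ _ (1 + 2 * M)) => [|e e0]; first by lra.
pose t := Num.min e 2^-1.
have t0 : 0 < t by rewrite lt_min e0/= invr_gt0.
have te : t <= e by rewrite ge_min lexx.
have t2 : t <= 2^-1 by rewrite ge_min lexx orbT.
suff : nrm (d n) <= (1 + 2 * M) * t by move/le_trans; apply; rewrite ler_wpM2l//; lra.
have tn0 : 0 < t ^+ n by rewrite exprn_gt0.
have tn1 : 0 < t ^+ n.+1 by rewrite exprn_gt0.
have [N hN] := (cvg_nrmP _ _).1 (hd t) _ tn1.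
have := hN (n.+1 + N)%N (leq_addl _ _); rewrite subr0 /series/=.
rewrite (@big_cat_nat _ _ _ n.+1)//= ?leq_addr// big_nat_recr//= big_nat big1 ?add0r.
  set T := \sum_(n.+1 <= m < n.+1 + N) _ => hT.
  have TM : nrm T <= 2 * t ^+ n.+1 * M.
    apply: (@le_trans _ _ ((\sum_(n.+1 <= m < n.+1 + N) t ^+ m) * M)).
      apply: le_trans (nrm_sum _ _ _) _; rewrite mulr_suml; apply: ler_sum => m _.
      by rewrite -rmorphXn/= nrmZr ger0_norm ?exprn_ge0 ?(ltW t0)// ler_wpM2l
        ?exprn_ge0 ?(ltW t0).
    rewrite ler_wpM2r//; apply: le_trans (geometric_tail _ _ (ltW t0) t2) _.
    by have := exprn_ge0 (n.+1 + N) (ltW t0); lra.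
  have : nrm (t%:C ^+ n *: d n) <= t ^+ n.+1 + 2 * t ^+ n.+1 * M.
    have := nrmB (t%:C ^+ n *: d n + T) T; rewrite addrK => /le_trans; apply.
    by apply: lerD TM; exact: ltW.
  rewrite -rmorphXn/= nrmZr ger0_norm ?(ltW tn0)// exprS => h.
  rewrite -(ler_pM2l tn0); apply: (le_trans h).
  by rewrite le_eqVlt; apply/orP; left; apply/eqP; ring.
by move=> m /andP[_ mn]; rewrite IH// scaler0.
Qed.

Lemma entire_eq (f g : R[i] -> V) : is_entire f -> is_entire g ->
  (forall t : R, f t%:C = g t%:C) -> f = g.
Proof.
move=> [c hc] [d hd] fg; suff cd n : c n - d n = 0.
  apply/funext => z; apply: (cvg_nrm_uniq (hc z)).
  rewrite (_ : c = d); first exact: hd.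
  by apply/funext => n; apply/eqP; rewrite -subr_eq0 cd.
apply: (power_series_eq0 (d := fun n => c n - d n)) => t.
have -> : series (fun n => t%:C ^+ n *: (c n - d n)) = (fun N =>
    series (fun n => t%:C ^+ n *: c n) N - series (fun n => t%:C ^+ n *: d n) N).
  apply/funext => N; rewrite /series/= -sumrB.
  by apply: eq_bigr => i _; rewrite scalerBr.
by rewrite -(subrr (g t%:C)) -{1}fg; exact: cvgB.
Qed.

Lemma entire_extensionE (f : R[i] -> V) (g : R -> V) : is_entire f ->
  (forall t : R, f t%:C = g t) -> entire_extension g = f.
Proof.
move=> ef fg; apply/funext => z; rewrite /entire_extension (@xget_unique _ _ _ f)//.
by move=> h [eh hg]; apply: entire_eq => // t; rewrite hg fg.
Qed.

Lemma is_entire_sum (n : nat) (F : 'I_n -> R[i] -> V) (c : 'I_n -> R[i]) :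
  (forall i, is_entire (F i)) -> is_entire (fun z => \sum_i c i *: F i z).
Proof.
move=> /choice[d hd]; exists (fun m => \sum_i c i *: d i m) => z.
rewrite (_ : series _ = fun N =>
    \sum_i c i *: series (fun m => z ^+ m *: d i m) N).
  apply: cvg_big => [|i _]; first exact: add_continuous.
  by apply: cvgZr; exact: hd.
apply/funext => N; rewrite /series/=; under [RHS]eq_bigr do rewrite scaler_sumr.
rewrite exchange_big/=; apply: eq_bigr => m _; rewrite scaler_sumr.
by apply: eq_bigr => i _; rewrite !scalerA mulrC.
Qed.

End EntireUniqueness.

(** * The exponential as an entire function *)

Section Exponential.
Variables (R : realType) (V : completeNormedModType R[i]).

Lemma cvg_series_complex (u : nat -> R[i]) (x y : R) (v : V) :
  series (fun n => complex.Re (u n)) @ \oo --> x ->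
  series (fun n => complex.Im (u n)) @ \oo --> y ->
  series (fun n => u n *: v) @ \oo --> (x +i* y) *: v.
Proof.
move=> /cvgrPdist_lt ux /cvgrPdist_lt uy; apply/cvg_nrmP => e e0.
have v0 := nrm_ge0 v; have c0 : 0 < nrm v + 1 by lra.
pose e' := e / 2 / (nrm v + 1); have e'0 : 0 < e' by rewrite !divr_gt0.
have [N _ hN] := ux e' e'0; have [M _ hM] := uy e' e'0.
exists (maxn N M) => n; rewrite geq_max => /andP[/hN/= h1 /hM/= h2].
rewrite /series/= -scaler_suml -scalerBl nrmZ -/(cabs _).
have h : cabs (\sum_(0 <= i < n) u i - x +i* y) <= e' + e'.
  apply: le_trans (cabs_le _) _.
  rewrite !raddfB/= !raddf_sum/= lerD//.
    by move/ltW: h1; rewrite distrC.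
  by move/ltW: h2; rewrite distrC.
have : (e' + e') * (nrm v + 1) = e by rewrite /e'; field; rewrite gt_eqF.
have := ler_wpM2r v0 h; rewrite /= => h3 h4; apply: le_lt_trans h3 _; nra.
Qed.

Definition exp_term (w : R[i]) (n : nat) : R[i] := w ^+ n / n`!%:R.

Lemma exp_term_real (x : R) n : exp_term x%:C n = (exp_coeff x n)%:C.
Proof. by rewrite /exp_term rmorphM/= rmorphXn fmorphV/= rmorph_nat. Qed.

Lemma exp_term_imag (s : R) n :
  exp_term ('i%C * s%:C) n = cos_coeff s n +i* sin_coeff s n.
Proof.
have iX m : 'i%C ^+ m.*2 = ((-1) ^+ m)%:C :> R[i].
  by rewrite -mul2n exprM sqr_i rmorphXn/= rmorphN1.
have E : exp_term ('i%C * s%:C) n = 'i%C ^+ n * (s ^+ n / n`!%:R)%:C.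
  by rewrite /exp_term exprMn -mulrA rmorphM/= rmorphXn fmorphV/= rmorph_nat.
rewrite E -[in 'i%C ^+ n](odd_double_half n) exprD iX /cos_coeff /sin_coeff /=.
case: (boolP (odd n)) => /= on; rewrite ?expr1 ?expr0.
  have -> : n.-1./2 = n./2 by rewrite -[in LHS](odd_double_half n) on /= doubleK.
  by apply/eqP; rewrite eq_complex/=; apply/andP; split; apply/eqP; ring.
by rewrite -exprnP mul1r; apply/eqP; rewrite eq_complex/=; apply/andP; split; apply/eqP; ring.
Qed.

Lemma exp_term_cvg (w : R[i]) (v : V) :
  exists l : V, series (fun n => exp_term w n *: v) @ \oo --> l.
Proof.
have cw := cabs_ge0 w; apply: cauchy_nrm => e e0.
have v0 := nrm_ge0 v; have c0 : 0 < nrm v + 1 by lra.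
pose e' := e / 2 / (nrm v + 1); have e'0 : 0 < e' by rewrite !divr_gt0.
have /cvgrPdist_lt/(_ e' e'0)[N _ hN] := is_cvg_series_exp_coeff (cabs w).
exists N => n Nn; have h1 := hN N (leqnn N); have h2 := hN n Nn.
have ab m : nrm (exp_term w m *: v) = exp_coeff (cabs w) m * nrm v.
  rewrite nrmZ; congr (_ * _); apply: (@complexI R).
  rewrite -/(cabs _) -cabsE -exp_term_real /exp_term normrM normfV normrX cabsE.
  by rewrite [`|_%:R|]ger0_norm.
rewrite /series/= (@big_cat_nat _ _ _ N 0 n)//= addrAC subrr add0r.
apply: le_lt_trans (nrm_sum _ _ _) _; under eq_bigr do rewrite ab.
rewrite -mulr_suml.
have : \sum_(N <= i < n) exp_coeff (cabs w) i <= e' + e'.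
  have -> : \sum_(N <= i < n) exp_coeff (cabs w) i =
      series (exp_coeff (cabs w)) n - series (exp_coeff (cabs w)) N.
    by rewrite /series/= (@big_cat_nat _ _ _ N 0 n)//= addrAC subrr add0r.
  move: h1 h2 => /=; rewrite !ltr_norml => /andP[? ?] /andP[? ?]; lra.
have : (e' + e') * (nrm v + 1) = e by rewrite /e'; field; rewrite gt_eqF.
move=> h3 /(ler_wpM2r v0)/= h4; apply: le_lt_trans h4 _; nra.
Qed.

(** f is z |-> exp(i k z) v. Its values are identified on the two axes, where real series suffice:
    cosine and sine on the real axis, the real exponential on the imaginary one, because i k (i b) =
    - k b. *)
Lemma exp_entire (k : R) (v : V) : exists f : R[i] -> V, [/\ is_entire f,
  forall t : R, f t%:C = expi (k * t) *: v &
  forall b : R, f ('i%C * b%:C) = (expR (- (k * b)))%:C *: v].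
Proof.
have [f hf] := choice (fun z => exp_term_cvg ('i%C * k%:C * z) v).
exists f; split=> [|t|b].
- exists (fun n => exp_term ('i%C * k%:C) n *: v) => z.
  rewrite (_ : series _ = series (fun n => exp_term ('i%C * k%:C * z) n *: v)).
    exact: hf.
  congr series; apply/funext => i.
  by rewrite scalerA /exp_term [in RHS]exprMn mulrA (mulrC (z ^+ i)).
- apply: (cvg_nrm_uniq (hf _)); rewrite -mulrA -rmorphM/=.
  apply: cvg_series_complex; under eq_fun do rewrite exp_term_imag/=.
    by rewrite unlock; exact: is_cvg_series_cos_coeff.
  by rewrite unlock; exact: is_cvg_series_sin_coeff.
- apply: (cvg_nrm_uniq (hf _)).
  have -> : 'i%C * k%:C * ('i%C * b%:C) = (- (k * b))%:C :> R[i].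
    by rewrite mulrACA -expr2 sqr_i mulN1r rmorphN rmorphM.
  rewrite -[_%:C in X in _ --> X]/(expR (- (k * b)) +i* 0).
  apply: cvg_series_complex; under eq_fun do rewrite exp_term_real/=.
    exact: is_cvg_series_exp_coeff.
  rewrite (_ : series _ = fun=> 0); first exact: cvg_cst.
  by apply/funext => n; rewrite /series/= big1.
Qed.

End Exponential.

Section ComplexFlow.
Variables (R : realType) (A : cstarAlgType R[i]) (gamma : circle_action A).

Lemma complex_flow_sum n (k : 'I_n -> int) (c : 'I_n -> R[i]) (x : 'I_n -> A)
    (beta : R) : (forall i, spectral gamma (k i) (x i)) ->
  complex_flow gamma ('i%C * beta%:C) (\sum_i c i *: x i) =
  \sum_i (c i * (expR (- ((k i)%:~R * beta)))%:C) *: x i.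
Proof.
move=> kx; have [f hf] := choice (fun i => exp_entire (k i)%:~R (x i)).
pose F (z : R[i]) := \sum_i c i *: f i z.
have eF : is_entire F by apply: is_entire_sum => i; case: (hf i).
rewrite /complex_flow (entire_extensionE eF) => [|t].
  by apply: eq_bigr => i _; case: (hf i) => _ _ ->; rewrite scalerA.
have h1 := norm_expi t; rewrite /flow.
rewrite (big_morph (gamma (expi t)) (fun u v => circle_actD gamma u v h1)
  (circle_act0 gamma h1)).
apply: eq_bigr => i _; rewrite circle_actZ// kx//; case: (hf i) => _ -> _.
by rewrite mulrzl expi_mulrz.
Qed.

End ComplexFlow.

(** * States on the algebra and on its fixed-point algebra *)

Section States.
Variables (R : realType) (A : cstarAlgType R[i]).

Lemma Re_le_cabs (z : R[i]) : `|complex.Re z| <= cabs z.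
Proof. by rewrite -lecR -cabsE normc_ge_Re. Qed.

Lemma Im_le_cabs (z : R[i]) : `|complex.Im z| <= cabs z.
Proof.
have := Re_le_cabs (z * 'i%C); rewrite ReiNIm normrN cabsM.
by rewrite [cabs 'i%C]/cabs normc_def/= expr0n/= add0r expr1n sqrtr1 mulr1.
Qed.

Lemma approx_ge0 (q : R[i]) (C : R) : 0 <= C ->
  (forall e : R, 0 < e -> exists2 r : R[i], 0 <= r & cabs (q - r) <= C * e) ->
  0 <= q.
Proof.
move=> C0 h; have C1 : 0 < C + 1 by lra.
have {}h e : 0 < e -> exists2 r : R[i], 0 <= r & cabs (q - r) <= e.
  move=> e0; have [r r0 qr] := h (e / (C + 1)) (divr_gt0 e0 C1).
  exists r => //; apply: (le_trans qr).
  by rewrite mulrCA ger_pMr// ler_pdivrMr//; lra.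
rewrite lecE/=; apply/andP; split.
  rewrite -normr_eq0 eq_le normr_ge0 andbT; apply/ler_addgt0Pl => e /h[r r0 qr].
  have := Im_le_cabs (q - r); rewrite raddfB/= (ger0_Im r0) subr0; lra.
apply/ler_addgt0Pl => e /h[r]; rewrite lecE/= => /andP[_ r0] qr.
have := Re_le_cabs (q - r); rewrite raddfB/= ler_norml => /andP[h1 h2]; lra.
Qed.

Lemma lip_functional (f : A -> R[i]) : scalar f ->
  (forall a, cabs (f a) <= 2 * nrm a) -> nrm_lipschitz (f : A -> R[i]^o).
Proof. by move=> lf bf; apply: (@lip_linear _ _ _ _ 2). Qed.

Lemma cstar_state_bounded (omega : A -> R[i]) : is_state omega ->
  forall a, cabs (omega a) <= 2 * nrm a.
Proof.
move=> st a; apply: (state_bounded (p := @nrm R A)) => //.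
- exact: nrm_ge0.
- exact: nrmD.
- exact: nrmZ.
- exact: nrm_star.
- by move=> h sh /(cstar_selfadjoint_sqrt sh)[k [sk kk _]]; exists k.
Qed.

End States.

Section FixedStates.
Variables (R : realType) (A : cstarAlgType R[i]) (gamma : circle_action A).
Variable tau : fixed_alg gamma -> R[i].
Hypothesis tau_state : is_state tau.
Implicit Types (u : fixed_alg gamma) (a b : A).
Local Notation spectral := (spectral gamma).
Local Notation proj := (spectral_proj gamma).
Local Notation phi := (extend_fixed tau).

Let p u : R := nrm (val u).

Let p_ge0 u : 0 <= p u. Proof. exact: nrm_ge0. Qed.

Let pD u v : p (u + v) <= p u + p v.
Proof. by rewrite /p rmorphD/= nrmD. Qed.

Let pZ c u : p (c *: u) = complex.Re `|c| * p u.
Proof. by rewrite /p linearZ/= nrmZ. Qed.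

Let p_star u : p (star u) = p u.
Proof. exact: nrm_star. Qed.

Lemma spectral_val u : spectral 0 (val u).
Proof. exact: (elimT (fixed_predP _ _) (valP u)). Qed.

Let p_sqrt u : star u = u -> p u < 1 -> exists2 k, star k = k & k * k = 1 - u.
Proof.
move=> su u1; have svu : star (val u) = val u by rewrite -[in RHS]su.
have [k kk kS] := cstar_sqrt_one_sub u1.
have sk : star k = k.
  have : star (1 - k) = 1 - k.
    apply: (kS [set a | star a = a]) => [||a /= sa].
    - exact: (closed_lip_eq (@lip_star _ A) (@lip_id _ A)).
    - exact: star0.
    - by rewrite star_scaler starD starM svu sa.
  by rewrite starB star1 => /addrI/oppr_inj.
(* A^0 is closed, contains 0 and is stable under a |-> (u + a^2) / 2, so the root found in A lies in
   A^0. *)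
have k0 : spectral 0 k.
  have : spectral 0 (1 - k).
    apply: (kS (spectral 0)) => [||a a0].
    - exact: closed_spectral.
    - exact: spectral_zero.
    - apply/spectralZ/spectralD; first exact: spectral_val.
      by rewrite -[0]addr0; exact: spectral_mul.
  by move/(spectralB (@spectral_one _ _ gamma)); rewrite opprB addrC subrK.
exists (to_fixed k0); apply: val_inj; first exact: sk.
by rewrite rmorphM rmorphB rmorph1 /=.
Qed.

Lemma fixed_state_bounded u : cabs (tau u) <= 2 * nrm (val u).
Proof. exact: (state_bounded p_ge0 pD pZ p_star p_sqrt tau_state). Qed.

Lemma fixed_state_ge0 u (t : R) : star u = u -> 0 <= t ->
  nrm (t%:C *: 1 - val u) <= t -> 0 <= tau u.
Proof.
move=> su t0 ut; apply: (state_ge0 p_ge0 pZ p_sqrt tau_state su t0).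
exact: ut.
Qed.

Lemma scalar_tau : scalar tau. Proof. by case: tau_state. Qed.

Lemma scalar_extend : scalar phi.
Proof.
move=> c a b; rewrite /extend_fixed -scalar_tau; congr tau.
by apply: val_inj; rewrite linearP/= !val_expectation spectral_proj_linear.
Qed.

Lemma extend_bounded a : cabs (phi a) <= 2 * nrm a.
Proof.
apply: le_trans (fixed_state_bounded _) _; rewrite val_expectation.
by rewrite ler_wpM2l// spectral_proj_contractive.
Qed.

Lemma extend_fixedE a (a0 : spectral 0 a) : phi a = tau (to_fixed a0).
Proof.
rewrite /extend_fixed; congr tau; apply: val_inj.
by rewrite val_expectation spectral_proj_id.
Qed.

Lemma extend_spectral_eq0 k a : k != 0 -> spectral k a -> phi a = 0.
Proof.
move=> k0 ka; rewrite /extend_fixed.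
have -> : expectation gamma a = 0.
  by apply: val_inj; rewrite val_expectation rmorph0 (spectral_proj_eq0 k0).
exact: scalar_fun0 scalar_tau.
Qed.

End FixedStates.

(** * Propagation of the scaling relation to all degrees *)

Section ScalingInduction.
Variables (R : realType) (A : cstarAlgType R[i]) (gamma : circle_action A).
Hypothesis hfull : full_system gamma.
Variables (phi : A -> R[i]) (lam : R[i]).
Hypothesis phi_lin : scalar phi.
Hypothesis phi_lip : nrm_lipschitz (phi : A -> R[i]^o).
Hypothesis phi0 : forall a b, spectral gamma 0 a -> spectral gamma 0 b ->
  phi (a * b) = phi (b * a).
Hypothesis phi1 : forall a b, spectral gamma (-1) a -> spectral gamma 1 b ->
  phi (a * b) = lam * phi (b * a).
Local Notation spectral := (spectral gamma).

(* Write b in A^(n+1) as a limit of sums of u v b, with u in A^1 and v in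
   A^(-1), so that v b lies in A^n. *)
Lemma scaling_nat (n : nat) a b : spectral (- n%:Z) a -> spectral n%:Z b ->
  phi (a * b) = lam ^+ n * phi (b * a).
Proof.
elim: n a b => [|n IH] a b an bn; first by rewrite expr0 mul1r; exact: phi0.
(* For h = 1 the condition is the claim; for h = u v the induction hypothesis applies; fullness at
   degree 1 connects the two. *)
pose S := [set h | (phi (a * h * b) : R[i]^o) = lam ^+ n.+1 *: (phi (h * b * a) : R[i]^o)].
have clS : closed S.
  apply: closed_lip_eq.
    exact: (lip_comp phi_lip (lip_comp (lip_mulr b) (lip_mull a))).
  apply: lipZ.
  exact: (lip_comp phi_lip (lip_comp (lip_mulr a) (lip_mulr b))).
suff S1 : S 1 by move: S1; rewrite /S/= mulr1 mul1r.
have : spectral 0 1 by exact: spectral_one.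
rewrite -(hfull 1) => /closure_nrmP cl1.
apply/(closed_nrmP S).1 => // e /cl1[_ [m [c [x [hx ->]]]] lt]; eexists; last exact: lt.
rewrite /S/= mulr_sumr !mulr_suml (scalar_fun_sum _ _ _ phi_lin).
rewrite (scalar_fun_sum _ _ _ phi_lin) scaler_sumr; apply: eq_bigr => i _.
have [u u1 [v v1 <-]] := hx i.
rewrite -scalerAr -!scalerAl !(scalar_funZ _ _ phi_lin) /GRing.scale/= mulrCA.
(* Induction moves v b in front of a u; the relation in degree 1 then moves u in front of v b a, an
   element of A^(-1). *)
congr (_ * _); rewrite (_ : a * (u * v) * b = (a * u) * (v * b)); last by rewrite !mulrA.
rewrite IH; first last.
- by have := spectral_mul v1 bn; rewrite (_ : -1 + n.+1%:Z = n%:Z)//; lia.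
- by have := spectral_mul an u1; rewrite (_ : - n.+1%:Z + 1 = - n%:Z)//; lia.
rewrite exprSr -!mulrA; congr (_ * _); rewrite !mulrA phi1 ?mulrA//.
by have := spectral_mul (spectral_mul v1 bn) an;
  rewrite (_ : -1 + n.+1%:Z + - n.+1%:Z = -1)//; lia.
Qed.

Lemma scaling_int (k : int) a b : lam != 0 ->
  spectral (- k) a -> spectral k b -> phi (a * b) = lam ^ k * phi (b * a).
Proof.
move=> lam0; case: k => n ak bk; first exact: scaling_nat.
rewrite NegzE -exprnN (scaling_nat (n := n.+1) (a := b) (b := a)).
- by rewrite mulrA mulVf ?expf_neq0// mul1r.
- by rewrite -NegzE.
- by rewrite -[n.+1%:Z]opprK -NegzE.
Qed.

End ScalingInduction.

(** * The correspondence *)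

Section Correspondence.
Variables (R : realType) (A : cstarAlgType R[i]) (gamma : circle_action A).
Variable beta : R.
Implicit Types (a b : A) (k : int).
Local Notation spectral := (spectral gamma).
Local Notation proj := (spectral_proj gamma).

Lemma addr_neq0_or_oppr j k : j + k != 0 \/ j = - k.
Proof. by have [jk|jk] := eqVneq (j + k) 0; [right|left]; lia. Qed.

Lemma lin_span_spectral a : lin_span (\bigcup_(k : int) spectral k) a ->
  exists n (c : 'I_n -> R[i]) (k : 'I_n -> int) (x : 'I_n -> A),
    (forall i, spectral (k i) (x i)) /\ a = \sum_i c i *: x i.
Proof.
move=> [n [c [x [hx ->]]]].
have /choice[k hk] i : exists k, spectral k (x i) by have [k _ ?] := hx i; exists k.
by exists n, c, k, x.
Qed.

(** By density it suffices to treat spectral elements: on A^0 the action is trivial, and F_0 kills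
    every other A^k, which the action preserves. *)
Lemma spectral_proj_circle_act (w : R[i]) a : `|w| = 1 ->
  proj 0 (gamma w a) = proj 0 a.
Proof.
move=> w1; have plip : nrm_lipschitz (proj 0).
  apply: (@lip_linear _ _ _ _ 1) => // [|b]; first exact: spectral_proj_linear.
  by rewrite mul1r spectral_proj_contractive.
have glip : nrm_lipschitz (gamma w).
  apply: (@lip_linear _ _ _ _ 1) => // [|b]; first exact: circle_act_linear.
  by rewrite mul1r circle_act_contractive.
have cl := closed_lip_eq (lip_comp plip glip) plip.
apply: ((closed_nrmP _).1 cl a) => e e0.
have [n [k [x [_ kx ax]]]] := spectral_dense gamma a e0.
exists (\sum_i x i) => //=.
rewrite (big_morph (gamma w) (fun u v => circle_actD gamma u v w1) (circle_act0 gamma w1)).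
rewrite !spectral_proj_sum; apply: eq_bigr => i _; rewrite kx//.
have [ki0|ki0] := eqVneq (k i) 0; first by rewrite ki0 expr0z scale1r.
rewrite (spectral_proj_eq0 ki0 (kx i)) (spectral_proj_eq0 ki0)//.
exact: spectralZ.
Qed.

Section FromKMS.
Variable omega : A -> R[i].
Hypothesis kms : is_kms gamma beta omega.

Let omega_lin : scalar omega. Proof. by case: kms => -[]. Qed.

Lemma spectral_lin_span k a : spectral k a ->
  lin_span (\bigcup_(k : int) spectral k) a.
Proof.
move=> ka; exists 1%N, (fun=> 1), (fun=> a); split; first by move=> _; exists k.
by rewrite big_ord1 scale1r.
Qed.

Lemma kms_spectral j k a b : spectral j a -> spectral k b ->
  (expR (- (k%:~R * beta)))%:C * omega (a * b) = omega (b * a).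
Proof.
move=> ja kb; case: kms => _ + _.
move=> /(_ a b (spectral_lin_span ja) (spectral_lin_span kb)) <-.
have := @complex_flow_sum R A gamma 1 (fun=> k) (fun=> 1) (fun=> b) beta (fun=> kb).
rewrite !big_ord1 !scale1r mul1r => ->.
by rewrite -scalerAr (scalar_funZ _ _ omega_lin).
Qed.

Lemma kms_spectral_eq0 k a : k != 0 -> spectral k a -> omega a = 0.
Proof.
move=> k0 ka; have kr0 : (k%:~R : R) != 0 by rewrite intr_eq0.
have [b0|b0] := eqVneq beta 0.
  (* At t = pi / k the flow maps a to exp(i pi) a = - a, so omega a = - omega a. *)
  case: kms => _ _ /(_ b0 (pi / k%:~R) a); rewrite /flow ka ?norm_expi//.
  rewrite -expi_mulrz -mulrzr divfK// expi_pi (scalar_funZ _ _ omega_lin) mulN1r.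
  move=> /eqP; rewrite eq_sym -subr_eq0 opprK -mulr2n -mulr_natr mulf_eq0.
  by rewrite pnatr_eq0 orbF => /eqP.
have := kms_spectral (@spectral_one _ _ gamma) ka; rewrite mul1r mulr1 => /eqP.
rewrite -subr_eq0 -[X in _ - X]mul1r -mulrBl mulf_eq0 => /orP[|/eqP//].
rewrite subr_eq0 eq_complex/= eqxx andbT => /eqP; rewrite -[RHS]expR0 => /expR_inj/eqP.
by rewrite oppr_eq0 mulf_eq0 (negPf kr0) (negPf b0).
Qed.

Lemma restrict_scaled_tracial :
  scaled_tracial_state (expR beta) (restrict_fixed gamma omega).
Proof.
case: (kms) => -[_ pos one] _ _; split; first split; first split.
- by move=> c u v; rewrite /restrict_fixed linearP omega_lin.
- by move=> u; rewrite /restrict_fixed rmorphM; exact: pos.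
- by rewrite /restrict_fixed rmorph1.
- move=> u v; rewrite /restrict_fixed !rmorphM.
  have := kms_spectral (spectral_val u) (spectral_val v).
  by rewrite mul0r oppr0 expR0 rmorph1 mul1r.
(* [star y] has degree -1, which turns exp(- k beta) into exp(beta). *)
- move=> x y Sx Sy; have := kms_spectral Sx (spectral_star Sy).
  by rewrite mulN1r opprK.
Qed.

Lemma extend_restrict : extend_fixed (restrict_fixed gamma omega) = omega.
Proof.
have omega_lip : nrm_lipschitz (omega : A -> R[i]^o).
  by apply: lip_functional => //; apply: cstar_state_bounded; case: kms.
have proj_lip : nrm_lipschitz (proj 0).
  apply: (@lip_linear _ _ _ _ 1) => // [|a]; first exact: spectral_proj_linear.
  by rewrite mul1r spectral_proj_contractive.
apply/funext => a; rewrite /extend_fixed /restrict_fixed val_expectation.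
have cl := closed_lip_eq (lip_comp omega_lip proj_lip) omega_lip.
apply: ((closed_nrmP _).1 cl a) => e e0.
have [n [k [x [_ kx ax]]]] := spectral_dense gamma a e0.
exists (\sum_i x i) => //=; rewrite spectral_proj_sum !(scalar_fun_sum _ _ _ omega_lin).
apply: eq_bigr => i _; have [ki0|ki0] := eqVneq (k i) 0.
  by rewrite spectral_proj_id// -ki0.
by rewrite (spectral_proj_eq0 ki0)// (scalar_fun0 omega_lin) (kms_spectral_eq0 ki0).
Qed.

End FromKMS.

Section ToKMS.
Hypothesis hfull : full_system gamma.
Variable tau : fixed_alg gamma -> R[i].
Hypothesis tau_scaled : scaled_tracial_state (expR beta) tau.
Local Notation phi := (extend_fixed tau).

Let tau_state : is_state tau. Proof. by case: tau_scaled => -[]. Qed.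

Let phi_lin : scalar phi. Proof. exact: scalar_extend. Qed.

Let phi_lip : nrm_lipschitz (phi : A -> R[i]^o).
Proof. by apply: lip_functional => //; exact: extend_bounded. Qed.

Lemma extend_swap k a b : spectral (- k) a -> spectral k b ->
  phi (a * b) = (expR (k%:~R * beta))%:C * phi (b * a).
Proof.
have lam0 : (expR beta)%:C != 0 :> R[i].
  by rewrite eq_complex/= eqxx andbT gt_eqF// expR_gt0.
have -> : (expR (k%:~R * beta))%:C = (expR beta)%:C ^ k :> R[i].
  have nat n : (expR (n%:R * beta))%:C = (expR beta)%:C ^+ n :> R[i].
    by rewrite mulrC expRM_natr rmorphXn.
  case: k => n; first exact: nat.
  by rewrite NegzE -exprnN -nat mulrNz mulNr expRN fmorphV.
apply: (scaling_int hfull phi_lin phi_lip) => //.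
  move=> {}a {}b a0 b0; have ab : spectral 0 (a * b).
    by rewrite -[0]addr0; exact: spectral_mul.
  have ba : spectral 0 (b * a) by rewrite -[0]addr0; exact: spectral_mul.
  rewrite (extend_fixedE tau ab) (extend_fixedE tau ba).
  have := tau_scaled.1.2 (to_fixed a0) (to_fixed b0).
  have -> : to_fixed a0 * to_fixed b0 = to_fixed ab by apply: val_inj; rewrite rmorphM.
  by have -> : to_fixed b0 * to_fixed a0 = to_fixed ba by apply: val_inj; rewrite rmorphM.
move=> {}a {}b a1 b1; have sa1 : spectral 1 (star a).
  by have := spectral_star a1; rewrite opprK.
have := tau_scaled.2 b (star a) b1 sa1; rewrite -!extend_fixedE starK => <-.
by [].
Qed.

(* With x = b + b^* and y = i (b - b^* ), x^2 + y^2 = 2 (b^*b + bb^* ), and sums of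
   squares of self-adjoint elements are positive in norm terms; by scaling,
   phi (b^*b) and phi (bb^* ) have the same sign. *)
Lemma extend_star_mul_ge0 k b : spectral k b -> 0 <= phi (star b * b).
Proof.
move=> kb; have kb' := spectral_star kb; have sw := extend_swap kb' kb.
pose x := b + star b; pose y := 'i%C *: (b - star b).
have sx : star x = x by rewrite /x starD starK addrC.
have sy : star y = y.
  rewrite /y starZ starB starK -(opprB b) scalerN -scaleNr; congr (_ *: _).
  by apply/eqP; rewrite eq_complex/= oppr0 opprK !eqxx.
pose s := star b * b + b * star b.
have xy : x * x + y * y = s + s.
  pose d := b - star b.
  have -> : y * y = - (d * d).
    rewrite -scalerAl -scalerAr scalerA (_ : 'i%C * 'i%C = -1) ?scaleN1r//.
    by rewrite -expr2 sqr_i.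
  (* The difference x^2 - d^2 is factored without commutativity because x - d is just twice
     [star b]. *)
  have -> (u v : A) : u * u - v * v = u * (u - v) + (u - v) * v.
    by rewrite mulrBr mulrBl addrA subrK.
  have -> : x - d = star b + star b by rewrite /x /d opprB (addrC b) addrACA subrr addr0.
  have -> (u v w : A) : u * (v + v) + (v + v) * w = (u * v + v * w) + (u * v + v * w).
    by rewrite mulrDr mulrDl addrACA.
  suff -> : x * star b + star b * d = s by [].
  by rewrite /x /d mulrDl mulrBr addrACA subrr addr0 addrC.
have [t1 t10 h1] := selfadjoint_sqr_bound sx.
have [t2 t20 h2] := selfadjoint_sqr_bound sy.
have s0 : spectral 0 (s + s).
  have s0 : spectral 0 s.
    apply: spectralD; [rewrite -(addNr k)|rewrite -(subrr k)];
    exact: spectral_mul.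
  exact: spectralD.
have ss : 0 <= phi (s + s).
  rewrite (extend_fixedE tau s0).
  (* The norm conditions for x^2 and y^2 add up, with t1 + t2 as the new bound. *)
  apply: (fixed_state_ge0 tau_state (t := t1 + t2)); last 2 first.
  - exact: addr_ge0.
  - rewrite /= -xy rmorphD/= scalerDl opprD addrACA.
    by apply: le_trans (nrmD _ _) _; exact: lerD.
  apply: val_inj; rewrite /= -xy starD !starM sx sy.
  by [].
have l0 : 0 < expR (k%:~R * beta) by exact: expR_gt0.
move: ss; rewrite /s !(scalar_funD _ _ phi_lin) sw.
set l := expR _ in l0 *; set q := phi _.
(* With l = exp(k beta) and q = phi (b * star b), phi (star b * b) is l q; hence phi (s + s) = 2 (l
   + 1) q, and q >= 0. *)
have -> : l%:C * q + q + (l%:C * q + q) = (l + 1 + (l + 1))%:C * q.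
  by rewrite !rmorphD rmorph1; ring.
rewrite pmulr_rge0; last by rewrite ltcR !addr_gt0.
by move=> q0; rewrite mulr_ge0// ler0c ltW.
Qed.

(** For a sum b of elements b_i of distinct degrees k_i, the cross terms star b_i * b_j have degree
    k_j - k_i <> 0, so that phi (star b * b) is the sum of the phi (star b_i * b_i). Density and
    boundedness of phi then reach every a. *)
Lemma extend_state : is_state phi.
Proof.
split=> // [a|]; last first.
  have e1 : spectral 0 1 by exact: spectral_one.
  rewrite (extend_fixedE tau e1); case: tau_state => _ _ <-; congr tau.
  by apply: val_inj; rewrite rmorph1.
have a0 := nrm_ge0 a.
apply: (@approx_ge0 _ _ (2 * (2 * nrm a + 1))) => [|e e0]; first lra.
(* The cap 1 gives |b| <= |a| + 1, so [star a * a] and [star b * b] differ by at most (2 |a| + 1) e;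
   the other factor 2 is the bound on phi. *)
pose e' := Num.min e 1; have e'0 : 0 < e' by rewrite lt_min e0/=.
have [n [k [x [kinj kx ax]]]] := spectral_dense gamma a e'0.
pose b := \sum_i x i; exists (phi (star b * b)).
  rewrite star_sum mulr_suml (scalar_fun_sum _ _ _ phi_lin); apply: sumr_ge0 => i _.
  rewrite mulr_sumr (scalar_fun_sum _ _ _ phi_lin) (bigD1 i)//= big1 ?addr0.
    exact: extend_star_mul_ge0 (kx i).
  move=> j ji; have kij : - k i + k j != 0.
    by rewrite addrC subr_eq0; apply: contra ji => /eqP/kinj ->.
  have sx := spectral_mul (spectral_star (kx i)) (kx j).
  exact: (extend_spectral_eq0 tau_state kij sx).
rewrite -(scalar_funB _ _ phi_lin); apply: le_trans (extend_bounded tau_state _) _.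
rewrite -mulrA ler_wpM2l//.
have -> : star a * a - star b * b = star a * (a - b) + star (a - b) * b.
  by rewrite starB mulrBr mulrBl addrA subrK.
have h1 := nrmM (star a) (a - b); have h2 := nrmM (star (a - b)) b.
have ab : nrm (a - b) < e' by exact: ax.
have eb : e' <= e /\ e' <= 1 by split; rewrite ge_min lexx ?orbT.
have b1 : nrm b <= nrm a + 1.
  have := nrmB a (a - b); rewrite opprB addrC subrK; lra.
apply: le_trans (nrmD _ _) _; rewrite !nrm_star in h1 h2.
have := nrm_ge0 (a - b); have := nrm_ge0 b; nra.
Qed.

Lemma extend_kms : is_kms gamma beta phi.
Proof.
split; first exact: extend_state.
  move=> a b /lin_span_spectral[n [c [k [x [kx ->]]]]].
  move=> /lin_span_spectral[m [d [l [y [ly ->]]]]].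
  rewrite (@complex_flow_sum _ _ gamma m l d y beta ly) !mulr_suml !(scalar_fun_sum _ _ _ phi_lin).
  under eq_bigr do rewrite mulr_sumr (scalar_fun_sum _ _ _ phi_lin).
  under [RHS]eq_bigr do rewrite mulr_sumr (scalar_fun_sum _ _ _ phi_lin).
  rewrite [RHS]exchange_big/=; apply: eq_bigr => i _; apply: eq_bigr => j _.
  rewrite -!scalerAl -!scalerAr !(scalar_funZ _ _ phi_lin).
  (* Unless the degrees cancel, both sides vanish; if they cancel, the factor of the swap is the
     inverse of the factor of the flow. *)
  have [kl|kl] := addr_neq0_or_oppr (k i) (l j).
    rewrite (extend_spectral_eq0 tau_state kl (spectral_mul (kx i) (ly j))).
    have lk : l j + k i != 0 by rewrite addrC.
    by rewrite (extend_spectral_eq0 tau_state lk (spectral_mul (ly j) (kx i))) !mulr0.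
  have xi := kx i; rewrite kl in xi; rewrite (extend_swap xi (ly j)).
  have := expRxMexpNx_1 ((l j)%:~R * beta).
  move=> /(congr1 (real_complex R)); rewrite rmorphM rmorph1 => h.
  rewrite -[RHS]mul1r -h; ring.
move=> _ t a; rewrite /extend_fixed; congr tau; apply: val_inj.
by rewrite !val_expectation /flow spectral_proj_circle_act ?norm_expi.
Qed.

Lemma restrict_extend : restrict_fixed gamma phi = tau.
Proof.
apply/funext => u; rewrite /restrict_fixed (extend_fixedE tau (spectral_val u)).
by congr tau; apply: val_inj.
Qed.

End ToKMS.
End Correspondence.

Theorem proposition1p3 (R : realType) (A : cstarAlgType (R[i]))
    (gamma : circle_action A) (beta : R) (hfull : full_system gamma) :
  [/\ (forall omega : A -> R[i], is_kms gamma beta omega ->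
         scaled_tracial_state (expR beta) (restrict_fixed gamma omega)),
      (forall tau : fixed_alg gamma -> R[i],
         scaled_tracial_state (expR beta) tau ->
         is_kms gamma beta (extend_fixed tau)),
      (forall omega : A -> R[i], is_kms gamma beta omega ->
         extend_fixed (restrict_fixed gamma omega) = omega)
    & (forall tau : fixed_alg gamma -> R[i],
         scaled_tracial_state (expR beta) tau ->
         restrict_fixed gamma (extend_fixed tau) = tau)].
Proof.
split=> [omega kms|tau tau_scaled|omega kms|tau tau_scaled].
- exact: restrict_scaled_tracial.
- exact: extend_kms.
- exact: extend_restrict kms.
- exact: restrict_extend.
Qed.
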